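(* Let $n\ge1$ and $\beta=1$. Assume the following (conjectured) formula (F) for $A_n$ Selberg averages of products of $n+1$ Schur polynomials. For numbers of variables $N_1,\dots,N_n$ ($N_0=N_{n+1}=0$), parameters $u_1,\dots,u_n$ and $v_1=v$, $v_2=\dots=v_n=0$ ($v_{n+1}=0$), and arbitrary Young diagrams $Y_1,\dots,Y_{n+1}$, put $v'_r=\sum_{a=r}^n v_a$, and for $1\le t<s\le n+1$ put $u_{ts}=u_t+\dots+u_{s-1}$ and $X_{ts}=v_t-v_s+u_{ts}+N_t-N_{t-1}-N_s+N_{s-1}$. Then (F) $$\Big\langle\prod_{r=1}^{n+1}\chi_{Y_r}\big(p^{(r-1)}_k-p^{(r)}_k-v'_r\big)\Big\rangle_{\vec u,\vec v,1}=\prod_{s=1}^{n}\bigg\{(-1)^{|Y_s|}\frac{[v_s+N_s-N_{s-1}]_{Y'_s}}{[N_s+N_{s-1}]_{Y'_s}}\prod_{1\le i<j\le N_{s-1}+N_s}\frac{(j-i+1)_{Y'_{si}-Y'_{sj}}}{(j-i)_{Y'_{si}-Y'_{sj}}}\bigg\}\prod_{1\le i<j\le N_n}\frac{(j-i+1)_{Y_{(n+1)i}-Y_{(n+1)j}}}{(j-i)_{Y_{(n+1)i}-Y_{(n+1)j}}}$$ $$\times\prod_{1\le t<s\le n+1}\bigg\{\frac{[v_t+u_{ts}+N_t-N_{t-1}]_{Y'_t}}{[v_t-v_s+u_{ts}+N_t-N_{t-1}-N_s]_{Y'_t}}\cdot\frac{[-v_s+u_{ts}-N_s+N_{s-1}]_{Y_s}}{[v_t-v_s+u_{ts}-N_{t-1}-N_s+N_{s-1}]_{Y_s}}\prod_{i=1}^{N_t}\prod_{j=1}^{N_{s-1}}\frac{X_{ts}+1-(i+j)}{X_{ts}+1+Y'_{ti}+Y_{sj}-(i+j)}\bigg\}.$$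 Consider the four-point $SU(n+1)$ Toda Dotsenko-Fateev integral at $\beta=1$, with ''$+$'' data $(N_a,u_{a+},v_{a+})$ and ''$-$'' data $(\tilde N_a,u_{a-},v_{a-})$, $1\le a\le n$, related by charge conservation $u_{a+}+u_{a-}+v_{a+}+v_{a-}+\sum_b C_{ab}(N_b+\tilde N_b)=0$, where $C$ is the $A_n$ Cartan matrix. Let $N^{\rm Toda}_{\vec Y}=N^{\rm Toda}_{\vec Y+}N^{\rm Toda}_{\vec Y-}$ be its expansion coefficients, and let $N^{\rm inst}_{\vec Y}=N^{\rm inst}_{\vec Y+}N^{\rm inst}_{\vec Y-}$ be the instanton coefficients of the $SU(n+1)$ gauge theory with $2n+2$ fundamental hypermultiplets, with vacuum parameters $a_1,\dots,a_{n+1}$ and masses $\mu_1,\dots,\mu_{2n+2}$ (all defined in the context). Identify the parameters as follows. ''$+$'' side: with $N_a$, $u_a=u_{a+}$, $v_a=v_{a+}$ (so $v_{2+}=\dots=v_{n+}=0$), $$\mu_s+a_s=v_s+N_s-N_{s-1}\quad(1\le s\le n+1),$$ $$a_t-a_s=X_{ts},\quad \mu_s+a_t=v_t+u_{ts}+N_t-N_{t-1},\quad \mu_t+a_s=v_s-u_{ts}+N_s-N_{s-1}\quad(1\le t<s\le n+1).$$ ''$-$'' side: the same relations after reversing the order of the labels, that is, with $N_b,u_b,v_b$ replaced by $\tilde N_{n+1-b},u_{(n+1-b)-},v_{(n+1-b)-}$ (the constraint $v_2=\dots=v_n=0$ being imposed on these reversed parameters), $a_b$ replaced by $a_{n+2-b}$,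 and $\mu_b$ replaced by $\mu_{n+1+b}$. Then for arbitrary $\vec Y=(Y_1,\dots,Y_{n+1})$ $$N^{\rm Toda}_{\vec Y+}=N^{\rm inst}_{\vec Y+},\qquad N^{\rm Toda}_{\vec Y-}=N^{\rm inst}_{\vec Y-},$$ hence $N^{\rm Toda}_{\vec Y}=N^{\rm inst}_{\vec Y}$. Consequently the $SU(n+1)$ AGT relation holds at $\beta=1$: $Z_{\rm inst}(q)=Z_{\rm DF}(q)$ up to a $U(1)$ factor.
   Context: A Young diagram $Y$ is a partition $Y_1\ge Y_2\ge\cdots\ge0$ with cells $(i,j)$, $1\le j\le Y_i$; $Y'$ is its transpose and $|Y|$ its number of cells. For a tuple $\vec Y=(Y_1,\dots,Y_{n+1})$, $|\vec Y|=\sum_s|Y_s|$, $Y_{si}$ is the $i$-th part of $Y_s$ and $Y'_{si}$ the $i$-th part of $Y'_s$. At $\beta=1$: $$[x]_A=\prod_{(i,j)\in A}\big(x-(i-1)+(j-1)\big),\qquad f_A(z)=\prod_{(i,j)\in A}\big(z+(i-1)-(j-1)\big),$$ $$G_{A,B}(x)=\prod_{(i,j)\in A}\big(x+(A'_j-i)+(B_i-j)+1\big),\qquad (x)_k=\frac{\Gamma(x+k)}{\Gamma(x)}.$$ $\chi_Y$ is the Schur polynomial written as a polynomial in power sums $p_k$; $\chi_Y(g_k)$ means each $p_k$ is replaced by $g_k$. The $A_n$ Selberg average at $\beta=1$ is $$\langle f\rangle_{\vec u,\vec v,1}=\frac1S\int dx\prod_{a=1}^{n}\Big[|\Delta(x^{(a)})|^{2}\prod_{i=1}^{N_a}(x^{(a)}_i)^{u_a}(1-x^{(a)}_i)^{v_a}\Big]\prod_{a=1}^{n-1}|\Delta(x^{(a)},x^{(a+1)})|^{-1}f(x),$$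 with variables $x^{(a)}_1,\dots,x^{(a)}_{N_a}$ integrated over $[0,1]$, $S$ the same integral with $f=1$, $\Delta(x)=\prod_{i<j}(x_i-x_j)$, $\Delta(x,y)=\prod_{i,j}(x_i-y_j)$. Power sums: $p^{(a)}_k=\sum_i(x^{(a)}_i)^k$, $p^{(0)}_k=p^{(n+1)}_k=0$. Parameters are taken so that the expressions written are defined. Toda side. The four-point function has vertex operators of momenta $\alpha_1,\alpha_2,\alpha_3,\alpha_4$ at $0,q,1,\infty$, with $N_a$ screening currents for the simple root $e_a$ integrated over $[0,q]$ and $\tilde N_a$ over $[1,\infty]$; $u_{a+}=(\alpha_1,e_a)$, $v_{a+}=(\alpha_2,e_a)$, $v_{a-}=(\alpha_3,e_a)$, $u_{a-}=(\alpha_4,e_a)$. Let $\langle\cdot\rangle_+$ be the Selberg average over variables $x^{(a)}_i$ ($N_a$ of them) with parameters $u_{a+},v_{a+}$, and $\langle\cdot\rangle_-$ that over variables $y^{(a)}_i$ ($\tilde N_a$ of them) with parameters $u_{a-},v_{a-}$; $\tilde p^{(a)}_k=\sum_i(y^{(a)}_i)^k$, $\tilde p^{(0)}_k=\tilde p^{(n+1)}_k=0$. After rescaling the integration variables, and up to $U(1)$ prefactors, the Dotsenko-Fateev integral is $$Z_{\rm DF}(q)=\Big\langle\Big\langle\prod_{a=1}^n\prod_i(1-qx^{(a)}_i)^{v_{a-}}\prod_j(1-qy^{(a)}_j)^{v_{a+}}\prod_{a,b=1}^n\prod_{i,j}(1-qx^{(a)}_iy^{(b)}_j)^{C_{ab}}\Big\rangle_+\Big\rangle_-,$$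 and, up to a $U(1)$ factor (a power of $1-q$), $Z_{\rm DF}(q)=\sum_{\vec Y}q^{|\vec Y|}N^{\rm Toda}_{\vec Y+}N^{\rm Toda}_{\vec Y-}$ with $$N^{\rm Toda}_{\vec Y+}=\Big\langle\prod_{a=1}^{n+1}\chi_{Y_a}\Big(p^{(a-1)}_k-p^{(a)}_k-\sum_{s=a}^n v_{s+}\Big)\Big\rangle_+,\qquad N^{\rm Toda}_{\vec Y-}=\Big\langle\prod_{a=1}^{n+1}\chi_{Y_a}\Big(\tilde p^{(a)}_k-\tilde p^{(a-1)}_k-\sum_{s=1}^{a-1}v_{s-}\Big)\Big\rangle_-.$$ Gauge side. The instanton part of the Nekrasov partition function is, at $\beta=1$, $$Z_{\rm inst}(q)=\sum_{\vec Y}q^{|\vec Y|}N^{\rm inst}_{\vec Y},\qquad N^{\rm inst}_{\vec Y}=\frac{\prod_{s=1}^{n+1}\prod_{k=1}^{2n+2}f_{Y_s}(\mu_k+a_s)}{\prod_{t,s=1}^{n+1}G_{Y_t,Y_s}(a_t-a_s)^2}=N^{\rm inst}_{\vec Y+}N^{\rm inst}_{\vec Y-},$$ $$N^{\rm inst}_{\vec Y+}=\prod_{s=1}^{n+1}(-1)^{|Y_s|}\frac{\prod_{s=1}^{n+1}\prod_{k=1}^{n+1}f_{Y_s}(\mu_k+a_s)}{\prod_{t,s=1}^{n+1}G_{Y_t,Y_s}(a_t-a_s)},\qquad N^{\rm inst}_{\vec Y-}=\prod_{s=1}^{n+1}(-1)^{|Y_s|}\frac{\prod_{s=1}^{n+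1}\prod_{k=n+2}^{2n+2}f_{Y_s}(\mu_k+a_s)}{\prod_{t,s=1}^{n+1}G_{Y_t,Y_s}(a_t-a_s)}.$$
   Formalization: For diagrams exceeding the N's, where (F) fails literally (n=N=1, Y=(∅,(1,1))), its right side is read as the rational continuation in N_1..N_n; averages whose integrals diverge are read as any normalized linear functional satisfying (F), rationally continued in u,v where possible. *)

(* Defs.v *)
From HB Require Import structures.
From mathcomp Require Import all_boot all_order all_algebra.
From mathcomp Require Import all_classical all_reals all_analysis.
From mathcomp Require Import complex.

Set Implicit Arguments.
Unset Strict Implicit.
Unset Printing Implicit Defensive.

Import Order.TTheory GRing.Theory Num.Theory.
Import numFieldNormedType.Exports.

Local Open Scope ring_scope.
Local Open Scope complex_scope.

(** Index conventions.  Families labelled 1, .., n have type ['I_n -> T] and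
    families labelled 1, .., n+1 have type ['I_n.+1 -> T]; the ordinal [s]
    carries the label [s.+1].  [lab x k] is the member with label [k], and is
    zero for every [k] outside 1, .., n; this provides N_0 = N_{n+1} = 0,
    v_{n+1} = 0 and p^{(0)} = p^{(n+1)} = 0. *)
Definition lab (T : nmodType) (n : nat) (x : 'I_n -> T) (k : nat) : T :=
  if k is j.+1 then oapp x 0 (insub j) else 0.

(** * Young diagrams *)

Definition is_young (Y : seq nat) : bool := sorted geq Y && (0%N \notin Y).

(* [part Y i] is Y_i with i >= 1. *)
Definition part (Y : seq nat) (i : nat) : nat := nth 0%N Y i.-1.

Definition transpose (Y : seq nat) : seq nat :=
  [seq count (leq j) Y | j <- iota 1 (part Y 1)].

Section Combinatorics.
Variable K : fieldType.
Implicit Types (A B Y : seq nat) (x z : K).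

Definition prod_cells Y (F : nat -> nat -> K) : K :=
  \prod_(1 <= i < (size Y).+1) \prod_(1 <= j < (part Y i).+1) F i j.

Definition bracket x A : K :=
  prod_cells A (fun i j => x - (i%:R - 1) + (j%:R - 1)).

Definition nek_f A z : K :=
  prod_cells A (fun i j => z + (i%:R - 1) - (j%:R - 1)).

Definition nek_G A B x : K :=
  prod_cells A (fun i j =>
    x + ((part (transpose A) j)%:R - i%:R) + ((part B i)%:R - j%:R) + 1).

(* Gamma(x + k) / Gamma(x) for a natural number k *)
Definition poch x (k : nat) : K := \prod_(i < k) (x + i%:R).

(** [complete_rev p k] is the list h_k, h_{k-1}, .., h_0 of complete symmetric
    functions written in the power sums p_1, p_2, .., by Newton's identity
    k h_k = p_1 h_{k-1} + .. + p_k h_0. *)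
Fixpoint complete_rev (p : nat -> K) (k : nat) : seq K :=
  if k is k'.+1 then
    let hs := complete_rev p k' in
    ((\sum_(i < k) p i.+1 * hs`_i) / k%:R) :: hs
  else [:: 1].

Definition complete (p : nat -> K) (k : nat) : K := (complete_rev p k)`_0.

(** The Schur polynomial as a polynomial in power sums: the Jacobi-Trudi
    determinant of the h_{Y_i - i + j}, where h_m = 0 for m < 0.  The value
    [p 0] is not used. *)
Definition schur Y (p : nat -> K) : K :=
  \det (\matrix_(i < size Y, j < size Y)
    (if (i <= part Y i.+1 + j)%N then complete p (part Y i.+1 + j - i) else 0)).

(** * The formula for Selberg averages of products of n+1 Schur polynomials *)

Definition X_ n (N : 'I_n -> nat) (u v : 'I_n -> K) (t s : nat) : K :=
  lab v t - lab v s + \sum_(t <= k < s) lab u k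
  + (lab N t)%:R - (lab N t.-1)%:R - (lab N s)%:R + (lab N s.-1)%:R.

Definition selberg_rhs n (N : 'I_n -> nat) (u v : 'I_n -> K)
    (Y : 'I_n.+1 -> seq nat) : K :=
  let N_ k : K := (lab N k)%:R in
  let v_ k := lab v k in
  let Y_ s := Y (inord s.-1) in
  let Y'_ s := transpose (Y_ s) in
  let u_ t s := \sum_(t <= k < s) lab u k in
  let ratio (L : seq nat) (M : nat) : K :=
    \prod_(1 <= i < M.+1) \prod_(i.+1 <= j < M.+1)
      (poch (j%:R - i%:R + 1) (part L i - part L j)
       / poch (j%:R - i%:R) (part L i - part L j)) in
  (\prod_(1 <= s < n.+1)
     ((-1) ^+ sumn (Y_ s)
      * (bracket (v_ s + N_ s - N_ s.-1) (Y'_ s)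
         / bracket (N_ s + N_ s.-1) (Y'_ s))
      * ratio (Y'_ s) (lab N s.-1 + lab N s)%N))
  * ratio (Y_ n.+1) (lab N n)
  * \prod_(1 <= t < n.+2) \prod_(t.+1 <= s < n.+2)
     ((bracket (v_ t + u_ t s + N_ t - N_ t.-1) (Y'_ t)
       / bracket (v_ t - v_ s + u_ t s + N_ t - N_ t.-1 - N_ s) (Y'_ t))
      * (bracket (- v_ s + u_ t s - N_ s + N_ s.-1) (Y_ s)
         / bracket (v_ t - v_ s + u_ t s - N_ t.-1 - N_ s + N_ s.-1) (Y_ s))
      * \prod_(1 <= i < (lab N t).+1) \prod_(1 <= j < (lab N s.-1).+1)
          ((X_ N u v t s + 1 - (i + j)%:R)
           / (X_ N u v t s + 1 + (part (Y'_ t) i)%:R + (part (Y_ s) j)%:R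
              - (i + j)%:R))).

(** The products of [selberg_rhs] bounded by numbers of variables only see
    Y'_{a,i} with i <= N_a and Y_{a+1,j} with j <= N_a; they see the whole
    diagrams exactly when Y_a has at most N_a columns and Y_{a+1} at most N_a
    rows, 1 <= a <= n. *)
Definition fits n (N : 'I_n -> nat) (Y : 'I_n.+1 -> seq nat) : Prop :=
  forall a : 'I_n, (part (Y (widen_ord (leqnSn n) a)) 1 <= N a)%N /\
                   (size (Y (lift ord0 a)) <= N a)%N.

(** * Rational continuation *)

(* polynomial functions on [T] in the coordinates [X] *)
Inductive polyfun (T I : Type) (X : I -> T -> K) : (T -> K) -> Prop :=
| polyfun_cst c : polyfun X (fun=> c)
| polyfun_var i : polyfun X (X i)
| polyfun_add f g : polyfun X f -> polyfun X g -> polyfun X (fun t => f t + g t)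
| polyfun_mul f g : polyfun X f -> polyfun X g -> polyfun X (fun t => f t * g t).

(** [z] is the value at [t] of a rational function that coincides with [g] on
    the domain [D].  It is determined by [g] as soon as [D] is Zariski dense,
    and equals [g t] when moreover [t] is a point of [D] where the denominator
    does not vanish. *)
Definition rational_value (T I : Type) (X : I -> T -> K) (D : T -> Prop)
    (g : T -> K) (t : T) (z : K) : Prop :=
  exists P Q : T -> K,
    [/\ polyfun X P, polyfun X Q, Q t != 0, z = P t / Q t
      & forall t', D t' -> Q t' != 0 -> g t' = P t' / Q t'].

(** * Instanton coefficients *)

Definition N_inst_half n (a mu : 'I_n.+1 -> K) (Y : 'I_n.+1 -> seq nat) : K :=
  (\prod_s (-1) ^+ sumn (Y s))
  * (\prod_s \prod_k nek_f (Y s) (mu k + a s))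
  / \prod_t \prod_s nek_G (Y t) (Y s) (a t - a s).

Definition N_inst_plus n (a : 'I_n.+1 -> K) (mu : 'I_(n.+1 + n.+1) -> K) :=
  N_inst_half a (fun k => mu (lshift n.+1 k)).

Definition N_inst_minus n (a : 'I_n.+1 -> K) (mu : 'I_(n.+1 + n.+1) -> K) :=
  N_inst_half a (fun k => mu (rshift n.+1 k)).

Definition N_inst n (a : 'I_n.+1 -> K) (mu : 'I_(n.+1 + n.+1) -> K)
    (Y : 'I_n.+1 -> seq nat) : K :=
  (\prod_s \prod_k nek_f (Y s) (mu k + a s))
  / \prod_t \prod_s nek_G (Y t) (Y s) (a t - a s) ^+ 2.

(** The coefficient of q^d in the instanton partition function.  A diagram
    with at most d cells is encoded by its first d parts, zeros included. *)
Definition Z_inst n (a : 'I_n.+1 -> K) (mu : 'I_(n.+1 + n.+1) -> K)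
    (d : nat) : K :=
  let padded (r : d.-tuple 'I_d.+1) : seq nat := map val r in
  \sum_(r : {ffun 'I_n.+1 -> d.-tuple 'I_d.+1} |
      [forall s, sorted geq (padded (r s))]
      && (\sum_s sumn (padded (r s)) == d)%N)
    N_inst a mu (fun s => [seq k <- padded (r s) | 0 < k]%N).

(** * Formal power series in q, as sequences of coefficients *)

Definition fps_one (d : nat) : K := (d == 0%N)%:R.

Definition fps_mul (f g : nat -> K) (d : nat) : K :=
  \sum_(i < d.+1) f i * g (d - i)%N.

(* (1 - q z)^c *)
Definition fps_binom (z c : K) (d : nat) : K :=
  (\prod_(i < d) (c - i%:R)) / d`!%:R * (- z) ^+ d.

(** * Parameters *)

Definition cartan n (a b : 'I_n) : K :=
  if a == b then 2%:R
  else if (a.+1 == b) || (b.+1 == a) then -1 else 0.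

Definition charge_conservation n (N Nt : 'I_n -> nat)
    (up vp um vm : 'I_n -> K) : Prop :=
  forall a, up a + um a + vp a + vm a
            + \sum_b cartan a b * (N b + Nt b)%:R = 0.

Definition dictionary n (N : 'I_n -> nat) (u v : 'I_n -> K)
    (a mu : 'I_n.+1 -> K) : Prop :=
  let N_ k : K := (lab N k)%:R in
  let v_ k := lab v k in
  let u_ t s := \sum_(t <= k < s) lab u k in
  (forall s : 'I_n.+1, mu s + a s = v_ s.+1 + N_ s.+1 - N_ s) /\
  (forall t s : 'I_n.+1, (t < s)%N ->
    [/\ a t - a s = X_ N u v t.+1 s.+1,
        mu s + a t = v_ t.+1 + u_ t.+1 s.+1 + N_ t.+1 - N_ t
      & mu t + a s = v_ s.+1 - u_ t.+1 s.+1 + N_ s.+1 - N_ s]).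

End Combinatorics.

(* reversal of the labels: label b becomes n + 1 - b *)
Definition rev_lab (T : Type) (n : nat) (x : 'I_n -> T) : 'I_n -> T :=
  fun b => x (rev_ord b).

(** * Selberg averages *)

(** [var N] indexes the integration variables: [Tagged _ i : var N] with
    [i : 'I_(N a)] stands for x^{(a)}_i, and [tag] returns [a]. *)
Definition var n (N : 'I_n -> nat) : finType := {a : 'I_n & 'I_(N a)}.

Section Selberg.
Variable R : realType.
Local Notation C := R[i].

(* iterated Lebesgue integral over [0,1] of the variables listed in [s] *)
Fixpoint iter_int (I : eqType) (s : seq I) (F : (I -> R) -> \bar R)
    (x : I -> R) : \bar R :=
  if s is i :: s' then
    \int[@lebesgue_measure R]_(t in `[0%R, 1%R]%classic)
      iter_int s' F (fun j => if j == i then t else x j)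
  else F x.

Definition cube_int (I : finType) (F : (I -> R) -> \bar R) : \bar R :=
  iter_int (enum I) F (fun=> 0).

Definition cube_intC (I : finType) (F : (I -> R) -> C) : C :=
  fine (cube_int (fun x => (complex.Re (F x))%:E))
  +i* fine (cube_int (fun x => (complex.Im (F x))%:E)).

(* x^w for x > 0 *)
Definition cpow (x : R) (w : C) : C :=
  let r := expR (complex.Re w * ln x) in
  (r * cos (complex.Im w * ln x)) +i* (r * sin (complex.Im w * ln x)).

Definition selberg_weight n (N : 'I_n -> nat) (u v : 'I_n -> C)
    (x : var N -> R) : C :=
  let x_ a (i : 'I_(N a)) := x (Tagged _ i) in
  (\prod_(a < n)
     ((`|\prod_(i < N a) \prod_(j < N a | (i < j)%N) (x_ a i - x_ a j)| ^+ 2)%:C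
      * \prod_(i < N a) (cpow (x_ a i) (u a) * cpow (1 - x_ a i) (v a))))
  * \prod_(a < n) \prod_(b < n | b == a.+1 :> nat)
      (`|\prod_(i < N a) \prod_(j < N b) (x_ a i - x_ b j)|^-1)%:C.

(* S converges absolutely and is nonzero. *)
Definition selberg_cvg n (N : 'I_n -> nat) (u v : 'I_n -> C) : Prop :=
  (cube_int (fun x : var N -> R => (complex.Re `|selberg_weight u v x|)%:E)
     < +oo)%E
  /\ cube_intC (@selberg_weight n N u v) != 0.

Definition selberg_integral n (N : 'I_n -> nat) (f : (var N -> R) -> C)
    (u v : 'I_n -> C) : C :=
  cube_intC (fun x => selberg_weight u v x * f x)
  / cube_intC (@selberg_weight n N u v).

Definition coord (I : Type) (i : I) (x : I -> R) : C := (x i)%:C.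

Definition param n (i : 'I_n + 'I_n) (uv : ('I_n -> C) * ('I_n -> C)) : C :=
  match i with inl a => uv.1 a | inr a => uv.2 a end.

(** [E] is the Selberg average <.>_{u,v,1} on polynomials f in the variables:
    a normalized linear functional, whose value at f is given by the quotient
    of integrals in the region of convergence and elsewhere by its rational
    continuation in (u,v).  If two adjacent N_a, N_{a+1} are positive, then
    |Delta(x^{(a)},x^{(a+1)})|^{-1} is not integrable on the cube and the region
    of convergence is empty: the third condition is then void, and [E] may be
    any normalized linear functional. *)
Definition selberg_average n (N : 'I_n -> nat) (u v : 'I_n -> C)
    (E : ((var N -> R) -> C) -> C) : Prop :=
  [/\ E (fun=> 1) = 1,
      forall (c : C) f g, polyfun (@coord (var N)) f ->
        polyfun (@coord (var N)) g ->
        E (fun x => c * f x + g x) = c * E f + E g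
    & forall f, polyfun (@coord (var N)) f ->
        rational_value (@param n) (fun uv => selberg_cvg N uv.1 uv.2)
          (fun uv => selberg_integral f uv.1 uv.2) (u, v) (E f)].

(* p^{(a)}_k for the label a *)
Definition psum n (N : 'I_n -> nat) (x : var N -> R) (a k : nat) : C :=
  lab (fun b : 'I_n => \sum_(i < N b) (x (Tagged _ i))%:C ^+ k) a.

(** * Toda side *)

Definition toda_plus_fun n (N : 'I_n -> nat) (v : 'I_n -> C)
    (Y : 'I_n.+1 -> seq nat) (x : var N -> R) : C :=
  \prod_(s < n.+1)
    schur (Y s) (fun k =>
      psum x s k - psum x s.+1 k - \sum_(s.+1 <= b < n.+1) lab v b).

Definition toda_minus_fun n (N : 'I_n -> nat) (v : 'I_n -> C)
    (Y : 'I_n.+1 -> seq nat) (y : var N -> R) : C :=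
  \prod_(s < n.+1)
    schur (Y s) (fun k =>
      psum y s.+1 k - psum y s k - \sum_(1 <= b < s.+1) lab v b).

(** The formula for averages of n+1 Schur polynomials at the point (N, u, v),
    for arbitrary diagrams.  The right-hand side is a rational function of N_1, .., N_n on the tuples that fit the
    diagrams, and this rational function is what is evaluated at N.  Literally
    evaluated beyond that range the products are truncated: for n = N_1 = 1,
    Y_1 empty and Y_2 = (1,1), the left-hand side vanishes identically while
    [selberg_rhs] does not. *)
Definition selberg_formula n (N : 'I_n -> nat) (u v : 'I_n -> C)
    (E : ((var N -> R) -> C) -> C) : Prop :=
  forall Y : 'I_n.+1 -> seq nat, (forall s, is_young (Y s)) ->
    rational_value (fun (a : 'I_n) (M : 'I_n -> nat) => (M a)%:R : C)
      (fun M => fits M Y) (fun M => selberg_rhs M u v Y)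
      N (E (toda_plus_fun v Y)).

(* the average [E] after reversal of the labels of the variables *)
Definition rev_average n (N : 'I_n -> nat) (E : ((var N -> R) -> C) -> C)
    (f : (var (rev_lab N) -> R) -> C) : C :=
  E (fun y => f (fun i => y (Tagged (fun a => 'I_(N a)) (tagged i)))).

(* power series in q of the integrand of the Dotsenko-Fateev integral *)
Definition df_integrand n (N Nt : 'I_n -> nat) (vp vm : 'I_n -> C)
    (x : var N -> R) (y : var Nt -> R) : nat -> C :=
  fps_mul
    (fps_mul
      (\big[@fps_mul C/@fps_one C]_(i : var N)
         fps_binom (x i)%:C (vm (tag i)))
      (\big[@fps_mul C/@fps_one C]_(j : var Nt)
         fps_binom (y j)%:C (vp (tag j))))
    (\big[@fps_mul C/@fps_one C]_(i : var N)
       \big[@fps_mul C/@fps_one C]_(j : var Nt)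
         fps_binom (x i * y j)%:C (cartan C (tag i) (tag j))).

(* the coefficient of q^d in the Dotsenko-Fateev integral *)
Definition Z_DF n (N Nt : 'I_n -> nat) (vp vm : 'I_n -> C)
    (Ep : ((var N -> R) -> C) -> C) (Em : ((var Nt -> R) -> C) -> C)
    (d : nat) : C :=
  Em (fun y => Ep (fun x => df_integrand vp vm x y d)).

End Selberg.

(* Main.v *)
Require Import Defs.
From HB Require Import structures.
From mathcomp Require Import all_boot all_order all_algebra.
From mathcomp Require Import all_classical all_reals all_analysis.
From mathcomp Require Import complex.
From mathcomp Require Import perm.
From mathcomp Require Import ring zify.

Set Implicit Arguments.
Unset Strict Implicit.
Unset Printing Implicit Defensive.

Import Order.TTheory GRing.Theory Num.Theory.

Local Open Scope ring_scope.
Local Open Scope complex_scope.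

(** For numbers of variables large enough to fit the diagrams, the right-hand
    side of (F) is the instanton coefficient.  Its diagonal factors match by
    the hook-content formula.  For a pair t < s, the product over the box
    N_t x N_{s-1} is cut along the boundary of Y_t and rewritten with the
    identity [prod_rows_cols] between the rows and the columns of a diagram;
    what is left telescopes as a product of Gamma(X + m)/Gamma(X), m an integer.
    No denominator vanishes, because definedness of all instanton coefficients
    forces a_t - a_s not to be an integer.  Both sides are rational along
    N + m(1,..,1), so they agree at N.  The "-" side is the "+" side with the
    labels reversed.

    For the AGT relation, write h(p) for exp(sum_k p_k q^k / k).  The
    Dotsenko-Fateev integrand is h of an exponent that is a sum of n+1 products
    of the arguments of the Toda functions, up to a constant, i.e. up to a
    power of 1 - q.  It remains to prove the Cauchy identity
    sum_Y s_Y(p) s_Y(p') q^|Y| = h(p p') for Jacobi-Trudi determinants in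
    arbitrary power sums.  Its coefficients satisfy Newton's recursion: by
    Newton's identity for the complete functions, |Y| s_Y(p) is the sum of
    p_k times the determinants with one row lowered by k, while p'_k s_Y(p') is
    the sum of the determinants with one row raised by k.  Summing over all
    sequences of row labels instead of the decreasing ones, which multiplies
    everything by d!, makes the lowering and the raising adjoint. *)

(** * Products over the cells of a diagram *)

(** Conjugate partitions are represented by functions [a], [a'] with [c < a i] exactly when
    [i < a' c]. Both products, filled up with the neutral element, run over the same rectangle of
    rows [k..N-1] and columns [0..L-1]. *)
Lemma exchange_cells (R : Type) (idx : R) (op : Monoid.com_law idx)
    (a a' : nat -> nat) (k N L : nat) (f : nat -> nat -> R) :
  (forall i c, (c < a i)%N = (i < a' c)%N) ->
  (forall c, (c < L)%N -> (a' c <= N)%N) ->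
  (forall i, (k <= i)%N -> (a i <= L)%N) ->
  \big[op/idx]_(k <= i < N) \big[op/idx]_(0 <= c < a i) f i c
  = \big[op/idx]_(0 <= c < L) \big[op/idx]_(k <= i < a' c) f i c.
Proof.
move=> conj a'N aL.
transitivity (\big[op/idx]_(k <= i < N) \big[op/idx]_(0 <= c < L)
                (if (c < a i)%N then f i c else idx)).
  apply: eq_big_nat => i /andP[ki _].
  by rewrite (big_nat_widen _ _ L) ?aL // big_mkcond.
rewrite exchange_big_nat /=; apply: eq_big_nat => c /andP[_ cL].
rewrite (big_nat_widen _ (a' c) N) ?a'N // [RHS]big_mkcond.
by apply: eq_bigr => i _; rewrite conj.
Qed.

Lemma conjugate_geq (a a' : nat -> nat) :
  (forall i c, (c < a i)%N = (i < a' c)%N) ->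
  forall i j, (i <= j)%N -> (a j <= a i)%N.
Proof.
move=> conj i j ij; case: ltnP => // aij; have := aij; rewrite conj.
by move/(leq_ltn_trans ij); rewrite -conj ltnn.
Qed.

Section Products.
Variable K : numFieldType.
Implicit Types (z : K) (a b : nat -> nat).

Lemma telescope_prod_div (w : nat -> K) m n :
  (m <= n)%N -> (forall i, (m <= i <= n)%N -> w i != 0) ->
  \prod_(m <= i < n) (w i / w i.+1) = w m / w n.
Proof.
elim: n => [|n IHn]; first by rewrite leqn0 => /eqP-> w0; rewrite big_geq ?divff ?w0.
rewrite leq_eqVlt => /predU1P[<- w0|]; first by rewrite big_geq ?divff ?w0 ?leqnn.
rewrite ltnS => mn w0; rewrite big_nat_recr //= IHn // => [|i /andP[mi ni]].
  by rewrite mulrA divfK // w0 ?mn ?leqnSn.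
by rewrite w0 // mi ltnW.
Qed.

(* Rows [k .. N-1] and columns [0 .. L-1] of a diagram, seen through the lattice
   path that separates the diagram from its complement. *)
Lemma prod_rows_cols z (a a' : nat -> nat) (k N L : nat) :
  (forall i c, (c < a i)%N = (i < a' c)%N) ->
  (forall c, (c < L)%N -> (k <= a' c <= N)%N) ->
  (forall i, (k <= i)%N -> (a i <= L)%N) ->
  (forall i c, (k <= i)%N -> (c <= L)%N -> z + c%:R - i%:R != 0) ->
  \prod_(k <= i < N) ((z - i%:R) / (z + (a i)%:R - i%:R))
  = \prod_(0 <= c < L) ((z + c%:R + 1 - (a' c)%:R) / (z + c%:R + 1 - k%:R)).
Proof.
move=> conj a'N aL z0.
transitivity (\prod_(k <= i < N) \prod_(0 <= c < a i)
   ((z + c%:R - i%:R) / (z + c.+1%:R - i%:R))).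
  apply: eq_big_nat => i /andP[ki _].
  rewrite (telescope_prod_div (w := fun c => z + c%:R - i%:R)) ?addr0 //.
  by move=> c /andP[_ ca]; rewrite z0 // (leq_trans ca) ?aL.
rewrite (exchange_cells _ _ conj _ aL); last by move=> c /a'N/andP[].
apply: eq_big_nat => c /andP[_ cL]; have /andP[ka' _] := a'N c cL.
(* One column to the right and one row down leave the content unchanged, so the same cell factors
   also telescope along the columns. *)
have E i : z + c%:R - i%:R = z + c.+1%:R - i.+1%:R.
  by rewrite -[c.+1%:R]natr1 -[i.+1%:R]natr1; ring.
under eq_bigr => i _ do rewrite E -[_ / _]invrK invf_div.
rewrite prodfV (telescope_prod_div (w := fun i => z + c.+1%:R - i%:R)) //.
  by rewrite invf_div -natr1 addrA.
by move=> i /andP[ki _]; rewrite z0.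
Qed.

End Products.

(** * Gamma quotients at integer shifts *)

Section IntegerGamma.
Variables (K : numFieldType) (X : K).
Hypothesis X_nonint : forall m : int, X + m%:~R != 0.

(* [g m] is [Gamma(X + m) / Gamma(X)]. *)
Lemma integer_gamma : exists g : int -> K,
  (forall m, g m != 0) /\ forall m, g (m + 1) = (X + m%:~R) * g m.
Proof.
pose g (m : int) : K := match m with
  | Posz k => \prod_(i < k) (X + i%:R)
  | Negz k => (\prod_(i < k.+1) (X - i.+1%:R))^-1 end.
have Xn k : X + k%:R != 0 by have := X_nonint k; rewrite -pmulrn.
have Xm k : X - k%:R != 0 by have := X_nonint (- k%:Z); rewrite mulrNz -pmulrn.
exists g; split=> [[k|k]|[k|[|k]]].
- by apply/prodf_neq0 => i _.
- by rewrite invr_eq0; apply/prodf_neq0 => i _.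
- have -> : Posz k + 1 = Posz k.+1 by lia.
  by rewrite /= big_ord_recr /= mulrC -pmulrn.
- rewrite /= big_ord0 big_ord1 NegzE mulrNz; exact/esym/(divff (Xm 1%N)).
have -> : Negz k.+1 + 1 = Negz k by lia.
rewrite /= [in RHS]big_ord_recr /= NegzE mulrNz -pmulrn invfM.
by rewrite mulrCA mulfV ?mulr1.
Qed.

Section Gamma.
Variable g : int -> K.
Hypothesis g_neq0 : forall m, g m != 0.
Hypothesis gS : forall m, g (m + 1) = (X + m%:~R) * g m.

Lemma prod_gamma_up (m : int) b (f : nat -> K) :
  (forall c, f c = X + (m + c%:Z)%:~R) ->
  \prod_(0 <= c < b) f c = g (m + b%:Z) / g m.
Proof.
move=> fE; elim: b => [|b IH]; first by rewrite big_geq // addr0 divff.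
rewrite big_nat_recr //= IH fE; have -> : m + b.+1%:Z = m + b%:Z + 1 by lia.
by rewrite gS; ring.
Qed.

Lemma prod_gamma_down (m : int) k N (f : nat -> K) : (k <= N)%N ->
  (forall i, f i = X + (m - i%:Z)%:~R) ->
  \prod_(k <= i < N) f i = g (m - k%:Z + 1) / g (m - N%:Z + 1).
Proof.
move=> kN fE; rewrite -(subnKC kN); elim: (N - k)%N => [|d IH].
  by rewrite addn0 big_geq // divff.
rewrite addnS big_nat_recr ?leq_addr //= IH fE.
have -> : m - (k + d)%:Z + 1 = (m - (k + d).+1%:Z + 1) + 1 by lia.
rewrite (gS (m - _ + 1)); have -> : m - (k + d).+1%:Z + 1 = m - (k + d)%:Z by lia.
have := X_nonint (m - (k + d)%:Z) => h; have := g_neq0 (m - (k + d)%:Z) => h'.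
by move: h h'; move: (X + _) (g (m - (k + d)%:Z)) => x y h h'; field; rewrite h h'.
Qed.
End Gamma.
End IntegerGamma.

(** * The box identity for a pair of diagrams *)

Section PairIdentity.
Variables (K : numFieldType) (X : K).
Hypothesis X_nonint : forall m : int, X + m%:~R != 0.

Lemma add_int_neq0 (m : int) (z : K) : z = X + m%:~R -> z != 0.
Proof. by move=> ->. Qed.

Lemma prod_seq_neq0 (I : Type) (r : seq I) (F : I -> K) :
  (forall i, F i != 0) -> \prod_(i <- r) F i != 0.
Proof. by move=> F0; elim/big_ind: _ => [|x y|//]; [exact: oner_neq0 | exact: mulf_neq0]. Qed.

(* The factors of the box inside [a] are the second product on the left.  The
   factors outside are grouped by columns of [a]. *)
Lemma prod_box_square (a a' b b' : nat -> nat) (N M : nat) :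
  (forall i c, (c < a i)%N = (i < a' c)%N) ->
  (forall i c, (c < b i)%N = (i < b' c)%N) ->
  (forall c, a' c <= N)%N -> (forall c, b' c <= M)%N -> (forall i, a i <= M)%N ->
  (\prod_(0 <= i < N) \prod_(0 <= j < M)
      ((X - 1 - i%:R - j%:R) / (X - 1 + (a i)%:R + (b j)%:R - i%:R - j%:R)))
  * (\prod_(0 <= i < N) \prod_(0 <= c < a i)
       (X - 1 + (a i)%:R + (b c)%:R - i%:R - c%:R))
  * (\prod_(0 <= j < M) \prod_(0 <= c < b j)
       (X + 1 - (b' c)%:R - (a' j)%:R + j%:R + c%:R))
  = (\prod_(0 <= i < N) \prod_(0 <= c < a i) (X - M%:R - i%:R + c%:R))
    * (\prod_(0 <= j < M) \prod_(0 <= c < b j) (X - N%:R - j%:R + c%:R)).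
Proof.
move=> ca cb a'N b'M aM.
have [g [g0 gS]] := integer_gamma X_nonint.
have bdec := conjugate_geq cb.
have adec := conjugate_geq (fun c i => esym (ca i c)).
pose D i j : K := X - 1 + (a i)%:R + (b j)%:R - i%:R - j%:R.
have D0 i j : D i j != 0.
  apply: (add_int_neq0 (m := (a i)%:Z + (b j)%:Z - i%:Z - j%:Z - 1)).
  by rewrite /D; ring.
(* [T] will come from the rows outside [a], [U] from the cells of [b], each through
   [prod_rows_cols]. Over all columns both run through the pairs [c < j < M] with the same factors,
   so they cancel in the end. *)
pose T j := \prod_(0 <= c < j) (X + (b j)%:R - j%:R + c%:R - (a' c)%:R).
pose U j := \prod_(j.+1 <= i < M) (X - (a' j)%:R + j%:R + (b i)%:R - i%:R).
have TU : \prod_(0 <= j < M) T j = \prod_(0 <= j < M) U j.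
  transitivity (\prod_(0 <= j < M) \prod_(0 <= c < M | (c < j)%N)
      (X + (b j)%:R - j%:R + c%:R - (a' c)%:R)).
    apply: eq_big_nat => j /andP[_ jM].
    by rewrite /T (big_nat_widen _ _ M) ?(ltnW jM).
  under eq_bigr do rewrite big_mkcond.
  rewrite exchange_big_nat /=; apply: eq_big_nat => c /andP[_ cM].
  rewrite -big_mkcond /U [RHS](big_nat_widenl _ 0) //=.
  by apply: eq_bigr => i _; ring.
have T0 j : T j != 0.
  apply/prod_seq_neq0 => c.
  by apply: (add_int_neq0 (m := (b j)%:Z - j%:Z + c%:Z - (a' c)%:Z)); ring.
have U0 j : U j != 0.
  apply/prod_seq_neq0 => i.
  by apply: (add_int_neq0 (m := - (a' j)%:Z + j%:Z + (b i)%:Z - i%:Z)); ring.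
(* The rows of [a] from [a' j] on have length at most [j], so [prod_rows_cols] applies with
   [k = a' j] and only the columns before [j]. *)
have denE j : \prod_(a' j <= i < N) D i j
    = g ((b j)%:Z - (a' j)%:Z) / g ((b j)%:Z - j%:Z - N%:Z) / T j.
  pose z := X - 1 + (b j)%:R - j%:R.
  have H1 c : (c < j)%N -> (a' j <= a' c <= N)%N.
    by move=> cj; rewrite a'N adec // ltnW.
  have H2 i : (a' j <= i)%N -> (a i <= j)%N by rewrite leqNgt -ca -leqNgt.
  have H3 i c : (a' j <= i)%N -> (c <= j)%N -> z + c%:R - i%:R != 0.
    move=> _ _; apply: (add_int_neq0 (m := (b j)%:Z - j%:Z + c%:Z - i%:Z - 1)).
    by rewrite /z; ring.
  have := prod_rows_cols ca H1 H2 H3.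
  rewrite !prodf_div.
  rewrite (prod_gamma_down X_nonint g0 gS (m := (b j)%:Z - j%:Z - 1) (f := fun i => z - i%:R)) //;
    last by move=> i; rewrite /z /=; ring.
  rewrite [X in _ = _ / X](prod_gamma_up g0 gS (m := (b j)%:Z - j%:Z - (a' j)%:Z));
    last by move=> i; rewrite /z /=; ring.
  have -> : (b j)%:Z - j%:Z - 1 - (a' j)%:Z + 1 = (b j)%:Z - j%:Z - (a' j)%:Z by ring.
  have -> : (b j)%:Z - j%:Z - 1 - N%:Z + 1 = (b j)%:Z - j%:Z - N%:Z by ring.
  have -> : (b j)%:Z - j%:Z - (a' j)%:Z + j%:Z = (b j)%:Z - (a' j)%:Z by ring.
  under eq_bigr => i _.
    rewrite (_ : z + (a i)%:R - i%:R = D i j); last by rewrite /z /D; ring.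
    over.
  under [in RHS]eq_bigr => i _.
    rewrite (_ : z + i%:R + 1 - (a' i)%:R = X + (b j)%:R - j%:R + i%:R - (a' i)%:R);
      last by rewrite /z; ring.
    over.
  rewrite -/(T j).
  set P := \prod_(a' j <= i < N) D i j.
  have P0 : P != 0 by apply/prod_seq_neq0 => i.
  set g1 := g _; set g2 := g _; set g3 := g _ => E.
  have [h1 h2 h3] : [/\ g1 != 0, g2 != 0 & g3 != 0] by split; exact: g0.
  apply: (mulIf (T0 j)); rewrite divfK //.
  have -> : T j = g1 / g2 / P * (g3 / g1) by rewrite E divfK // mulf_neq0 ?invr_eq0.
  by field; rewrite h1 h2 P0.
(* Here [prod_rows_cols] is applied to the rows of [b] from [j] on, whose length is at most [b j].
   The factor of row [j] itself is not in [U j]; it cancels against one step of [g]. *)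
have GBE j : (j < M)%N ->
  \prod_(0 <= c < b j) (X + 1 - (b' c)%:R - (a' j)%:R + j%:R + c%:R)
    = g ((b j)%:Z - (a' j)%:Z) / g (j%:Z - (a' j)%:Z - M%:Z + 1) / U j.
  move=> jM; pose z := X - (a' j)%:R + j%:R.
  have H1 c : (c < b j)%N -> (j <= b' c <= M)%N.
    by rewrite b'M andbT cb => /ltnW.
  have H2 i : (j <= i)%N -> (b i <= b j)%N by exact: bdec.
  have H3 i c : (j <= i)%N -> (c <= b j)%N -> z + c%:R - i%:R != 0.
    move=> _ _; apply: (add_int_neq0 (m := - (a' j)%:Z + j%:Z + c%:Z - i%:Z)).
    by rewrite /z; ring.
  have := prod_rows_cols cb H1 H2 H3.
  rewrite !prodf_div.
  rewrite (prod_gamma_down X_nonint g0 gS (m := j%:Z - (a' j)%:Z)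
    (f := fun i => z - i%:R)) ?(ltnW jM) //;
    last by move=> i; rewrite /z /=; ring.
  rewrite [X in _ = _ / X](prod_gamma_up g0 gS (m := 1 - (a' j)%:Z));
    last by move=> i; rewrite /z /=; ring.
  rewrite big_ltn //.
  have -> : j%:Z - (a' j)%:Z - j%:Z + 1 = 1 - (a' j)%:Z by ring.
  have -> : 1 - (a' j)%:Z + (b j)%:Z = ((b j)%:Z - (a' j)%:Z) + 1 by ring.
  rewrite (gS ((b j)%:Z - _)).
  have -> : z + (b j)%:R - j%:R = X + ((b j)%:Z - (a' j)%:Z)%:~R by rewrite /z; ring.
  under [in RHS]eq_bigr => i _.
    rewrite (_ : z + i%:R + 1 - (b' i)%:R
      = X + 1 - (b' i)%:R - (a' j)%:R + j%:R + i%:R); last by rewrite /z; ring.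
    over.
  rewrite -/(U j); set P := \prod_(0 <= c < b j) _.
  have h0 := X_nonint ((b j)%:Z - (a' j)%:Z).
  move: (U0 j) h0; set w := X + _ => u0 h0.
  set g1 := g _; set g2 := g _; set g3 := g _ => E.
  have [h1 h2 h3] : [/\ g1 != 0, g2 != 0 & g3 != 0] by split; exact: g0.
  have -> : P = g1 / g2 / (w * U j) * (w * g3 / g1).
    by rewrite E divfK // !mulf_neq0 ?invr_eq0.
  by field; rewrite h0 h1 h2 u0.
have numE j : \prod_(0 <= i < N) (X - 1 - i%:R - j%:R) = g (- j%:Z) / g (- j%:Z - N%:Z).
  rewrite (prod_gamma_down X_nonint g0 gS (m := - j%:Z - 1)) //; last by move=> i /=; ring.
  by congr (g _ / g _); ring.
have RA j : \prod_(0 <= i < a' j) (X - M%:R - i%:R + j%:R)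
    = g (j%:Z - M%:Z + 1) / g (j%:Z - M%:Z - (a' j)%:Z + 1).
  rewrite (prod_gamma_down X_nonint g0 gS (m := j%:Z - M%:Z)) //; last by move=> i /=; ring.
  by congr (g _ / g _); ring.
have RB j : \prod_(0 <= c < b j) (X - N%:R - j%:R + c%:R)
    = g ((b j)%:Z - N%:Z - j%:Z) / g (- N%:Z - j%:Z).
  rewrite (prod_gamma_up g0 gS (m := - N%:Z - j%:Z)) //; last by move=> i /=; ring.
  by congr (g _ / g _); ring.
(* Everything is collected under one product over [j], which numbers the columns of [a] and the rows
   of [b]. *)
rewrite [X in X * _ * _]exchange_big_nat /=.
rewrite (exchange_cells _ (fun i j => D i j) ca (L := M)) //.
rewrite (exchange_cells _ (fun i c => X - M%:R - i%:R + c%:R) ca (L := M)) //.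
rewrite -!big_split /=.
have -> : \prod_(0 <= j < M)
    (\prod_(0 <= i < N)
        ((X - 1 - i%:R - j%:R) / (X - 1 + (a i)%:R + (b j)%:R - i%:R - j%:R)) *
     \prod_(0 <= i < a' j) D i j *
     \prod_(0 <= c < b j) (X + 1 - (b' c)%:R - (a' j)%:R + j%:R + c%:R))
  = \prod_(0 <= j < M) (g (- j%:Z) / g (- j%:Z - N%:Z)
      * (g ((b j)%:Z - j%:Z - N%:Z) / g (j%:Z - (a' j)%:Z - M%:Z + 1))
      * (T j / U j)).
  apply: eq_big_nat => j /andP[_ jM].
  rewrite (GBE j jM) prodf_div numE -[\prod_(0 <= i < N) (_ - j%:R)]/(\prod_(0 <= i < N) D i j).
  rewrite (@big_cat_nat _ _ _ (a' j) 0 N) //= denE.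
  set P := \prod_(0 <= i < a' j) D i j.
  have P0 : P != 0 by apply/prod_seq_neq0 => i.
  have := T0 j; have := U0 j; have := g0 (- j%:Z - N%:Z).
  have := g0 (j%:Z - (a' j)%:Z - M%:Z + 1).
  have := g0 ((b j)%:Z - j%:Z - N%:Z); have := g0 ((b j)%:Z - (a' j)%:Z).
  move: (g _) (g _) (g _) (g _) (g _) => g1 g2 g3 g4 g5 h5 h4 h3 h2 u t.
  by field; rewrite h5 h4 h3 h2 u t P0.
rewrite !big_split /= !prodfV TU divff ?mulr1; last by apply/prod_seq_neq0 => j.
under [in X in _ = X * _]eq_bigr do rewrite RA.
under [in X in _ = _ * X]eq_bigr do rewrite RB.
rewrite !prodf_div.
(* The reflection of [j] into [M - 1 - j]. *)
have R : \prod_(0 <= j < M) g (- j%:Z) = \prod_(0 <= j < M) g (j%:Z - M%:Z + 1).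
  rewrite big_nat_rev /=; apply: eq_big_nat => j /andP[_ jM].
  by congr g; rewrite add0n subnS; lia.
rewrite R.
have -> : \prod_(0 <= j < M) g ((b j)%:Z - j%:Z - N%:Z)
  = \prod_(0 <= j < M) g ((b j)%:Z - N%:Z - j%:Z).
  by apply: eq_bigr => j _; congr g; ring.
have -> : \prod_(0 <= j < M) g (j%:Z - (a' j)%:Z - M%:Z + 1)
  = \prod_(0 <= j < M) g (j%:Z - M%:Z - (a' j)%:Z + 1).
  by apply: eq_bigr => j _; congr g; ring.
have -> : \prod_(0 <= j < M) g (- j%:Z - N%:Z) = \prod_(0 <= j < M) g (- N%:Z - j%:Z).
  by apply: eq_bigr => j _; congr g; ring.
have n0 (F : nat -> int) : \prod_(0 <= j < M) g (F j) != 0 by apply/prod_seq_neq0 => j.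
by field; rewrite !n0.
Qed.
End PairIdentity.

Lemma prod_nat_shift (K : numFieldType) (w : K) (n : nat) :
  (\prod_(0 <= c < n) (w + c%:R)) * (w + n%:R)
  = w * \prod_(0 <= c < n) (w + 1 + c%:R).
Proof.
rewrite -(big_nat_recr n 0 (fun c => w + c%:R)) //= big_nat_recl //= addr0.
by congr (_ * _); apply: eq_bigr => c _; rewrite -natr1; ring.
Qed.

(** Reduction to the case where [M] also bounds [a]: an empty row added to [b] multiplies both sides
    by the same nonzero factor [Q], so the identity descends from [M + 1] to [M]. *)
Lemma prod_box (K : numFieldType) (X : K) (a a' b b' : nat -> nat) (N M : nat) :
  (forall m : int, X + m%:~R != 0) ->
  (forall i c, (c < a i)%N = (i < a' c)%N) ->
  (forall i c, (c < b i)%N = (i < b' c)%N) ->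
  (forall c, a' c <= N)%N -> (forall c, b' c <= M)%N ->
  (\prod_(0 <= i < N) \prod_(0 <= j < M)
      ((X - 1 - i%:R - j%:R) / (X - 1 + (a i)%:R + (b j)%:R - i%:R - j%:R)))
  * (\prod_(0 <= i < N) \prod_(0 <= c < a i)
       (X - 1 + (a i)%:R + (b c)%:R - i%:R - c%:R))
  * (\prod_(0 <= j < M) \prod_(0 <= c < b j)
       (X + 1 - (b' c)%:R - (a' j)%:R + j%:R + c%:R))
  = (\prod_(0 <= i < N) \prod_(0 <= c < a i) (X - M%:R - i%:R + c%:R))
    * (\prod_(0 <= j < M) \prod_(0 <= c < b j) (X - N%:R - j%:R + c%:R)).
Proof.
move=> Xi ca cb a'N b'M.
have [m aM] : exists m, (forall i, a i <= M + m)%N.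
  by exists (a 0%N) => i; apply: leq_trans (leq_addl _ _); exact: (conjugate_geq ca).
elim: m M b'M aM => [|m IHm] M b'M aM.
  by apply: prod_box_square => // i; rewrite -[M]addn0.
have b0 : b M = 0%N by apply/eqP; rewrite -leqn0 leqNgt cb -leqNgt.
have := IHm M.+1 (fun c => leqW (b'M c)); rewrite addSnnS => /(_ aM).
have [g1 g2 g3] : [/\ forall i, X - 1 - i%:R - M%:R != 0,
    forall i, X - 1 + (a i)%:R + (b M)%:R - i%:R - M%:R != 0
  & forall i, X - M.+1%:R - i%:R != 0].
  split=> i.
  - by apply: (add_int_neq0 Xi (m := - 1 - i%:Z - M%:Z)); ring.
  - by apply: (add_int_neq0 Xi (m := - 1 + (a i)%:Z + (b M)%:Z - i%:Z - M%:Z)); ring.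
  - by apply: (add_int_neq0 Xi (m := - i%:Z - M.+1%:Z)); ring.
under eq_bigr do rewrite big_nat_recr //=.
rewrite big_split /= ![\prod_(0 <= j < M.+1) _]big_nat_recr //= b0.
rewrite ![\prod_(0 <= c < 0) _]big_geq // !mulr1.
set Q := \prod_(0 <= i < N) (_ / _).
have -> : \prod_(0 <= i < N) \prod_(0 <= c < a i) (X - M.+1%:R - i%:R + c%:R)
    = \prod_(0 <= i < N) \prod_(0 <= c < a i) (X - M%:R - i%:R + c%:R) * Q.
  rewrite -big_split /=; apply: eq_bigr => i _.
  move: (g2 i) (g3 i); rewrite b0 => h2 h3.
  have -> : X - 1 - i%:R - M%:R = X - M.+1%:R - i%:R by rewrite -natr1; ring.
  apply: (mulIf h2); rewrite mulrA divfK //.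
  have -> : X - 1 + (a i)%:R + 0 - i%:R - M%:R
    = X - M.+1%:R - i%:R + (a i)%:R by rewrite -natr1; ring.
  rewrite prod_nat_shift mulrC; congr (_ * _).
  by apply: eq_bigr => c _; rewrite -natr1; ring.
have Q0 : Q != 0.
  by apply: prod_seq_neq0 => i; rewrite mulf_neq0 ?invr_eq0 ?g1 // -b0 g2.
move=> E; apply: (mulIf Q0).
by rewrite mulrAC -[X in X * _ = _]mulrAC [RHS]mulrAC.
Qed.

(** * The hook-content formula *)

Lemma prod_fact_ratio (K : numFieldType) (n r : nat) :
  (\prod_(0 <= e < r) (n%:R + e.+1%:R)) * \prod_(0 <= c < n) (n%:R - c%:R)
  = (\prod_(0 <= e < r) e.+1%:R) * \prod_(0 <= c < n) (r.+1%:R + c%:R) :> K.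
Proof.
elim: r => [|r IHr].
  rewrite ![\prod_(0 <= _ < 0) _]big_geq // !mul1r big_nat_rev /=.
  apply: eq_big_nat => c /andP[_ cn].
  by rewrite add0n natrB // -(natr1 c); ring.
rewrite !big_nat_recr //= mulrAC IHr -!mulrA; congr (_ * _).
have := prod_nat_shift (r.+1%:R : K) n; rewrite natr1 => <-.
by congr (_ * _); exact: addrC.
Qed.

(** The formula holds row by row: [prod_rows_cols], applied to the rows below row [i], trades the
    differences of shifted parts for the hooks of row [i], and what remains is a quotient of
    factorials. *)
Lemma hook_content (K : numFieldType) (a a' : nat -> nat) (m : nat) :
  (forall i c, (c < a i)%N = (i < a' c)%N) -> (forall c, a' c <= m)%N ->
  (\prod_(0 <= i < m) \prod_(i.+1 <= j < m)
      (((a i)%:R - (a j)%:R + j%:R - i%:R) / (j%:R - i%:R)))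
  * (\prod_(0 <= i < m) \prod_(0 <= c < a i)
      ((a i)%:R - c%:R + (a' c)%:R - i%:R - 1))
  = \prod_(0 <= i < m) \prod_(0 <= c < a i) (m%:R - i%:R + c%:R) :> K.
Proof.
move=> ca a'm; rewrite -big_split /=; apply: eq_big_nat => i /andP[_ im].
have adec := conjugate_geq ca.
pose z : K := i%:R - (a i)%:R.
have H1 c : (c < a i)%N -> (i.+1 <= a' c <= m)%N by rewrite a'm andbT ca.
have H2 j : (i.+1 <= j)%N -> (a j <= a i)%N by move=> ij; apply/adec/ltnW.
have z0 (p q : nat) : (i < p)%N -> (q <= a i)%N -> z + q%:R - p%:R != 0.
  move=> ip qa; have -> : z + q%:R - p%:R = (i + q)%:R - (a i + p)%:R.
    by rewrite /z !natrD; ring.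
  by rewrite subr_eq0 eqr_nat neq_ltn; apply/orP; left; lia.
have := prod_rows_cols ca H1 H2 z0.
have -> : \prod_(i.+1 <= j < m) ((z - j%:R) / (z + (a j)%:R - j%:R))
  = \prod_(i.+1 <= j < m) (((a i)%:R + j%:R - i%:R)
                           / ((a i)%:R - (a j)%:R + j%:R - i%:R)).
  apply: eq_bigr => j _; rewrite -mulrNN -invrN.
  by congr (_ / _); rewrite /z; ring.
have -> : \prod_(0 <= c < a i) ((z + c%:R + 1 - (a' c)%:R) / (z + c%:R + 1 - i.+1%:R))
  = \prod_(0 <= c < a i) (((a i)%:R - c%:R + (a' c)%:R - i%:R - 1)
                           / ((a i)%:R - c%:R)).
  apply: eq_bigr => j _; rewrite -mulrNN -invrN.
  by congr (_ / _); rewrite /z -?natr1; ring.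
rewrite !prodf_div.
have P20 : \prod_(i.+1 <= j < m) ((a i)%:R - (a j)%:R + j%:R - i%:R) != 0 :> K.
  rewrite big_seq; elim/big_ind: _ => [|x y|j];
    [exact: oner_neq0 | exact: mulf_neq0 | rewrite mem_index_iota => /andP[ij _]].
  by rewrite -oppr_eq0; have := z0 _ _ ij (H2 _ ij); congr (_ != _); rewrite /z; ring.
have P40 : \prod_(0 <= c < a i) ((a i)%:R - c%:R) != 0 :> K.
  rewrite big_seq; elim/big_ind: _ => [|x y|c];
    [exact: oner_neq0 | exact: mulf_neq0 | rewrite mem_index_iota => /andP[_ ca']].
  by rewrite subr_eq0 eqr_nat neq_ltn ca' orbT.
have P50 : \prod_(i.+1 <= j < m) (j%:R - i%:R) != 0 :> K.
  rewrite big_seq; elim/big_ind: _ => [|x y|j];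
    [exact: oner_neq0 | exact: mulf_neq0 | rewrite mem_index_iota => /andP[ij _]].
  by rewrite subr_eq0 eqr_nat neq_ltn ij orbT.
(* Both sides of this identity are the factorial of [a i + (m - i - 1)]. *)
have := prod_fact_ratio K (a i) (m - i.+1).
have mi : (m - i.+1).+1 = (m - i)%N by lia.
have shiftE (f : nat -> K) : \prod_(i.+1 <= j < m) f j
    = \prod_(0 <= e < m - i.+1) f (e + i.+1)%N.
  by rewrite -[i.+1 in LHS]add0n big_addn.
have -> : \prod_(0 <= e < m - i.+1) ((a i)%:R + e.+1%:R)
  = \prod_(i.+1 <= j < m) ((a i)%:R + j%:R - i%:R) :> K.
  by rewrite shiftE; apply: eq_bigr => e _; rewrite natrD -!natr1; ring.
have -> : \prod_(0 <= e < m - i.+1) e.+1%:R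
  = \prod_(i.+1 <= j < m) (j%:R - i%:R) :> K.
  by rewrite shiftE; apply: eq_bigr => e _; rewrite natrD -!natr1; ring.
rewrite mi natrB ?(ltnW im) //.
move: P20 P40 P50.
move: (\prod_(i.+1 <= j < m) ((a i)%:R - (a j)%:R + j%:R - i%:R))
  (\prod_(0 <= c < a i) ((a i)%:R - c%:R)) (\prod_(i.+1 <= j < m) (j%:R - i%:R)) => A B C.
move=> A0 B0 C0 E /eqP; rewrite eqr_div // E => /eqP E'.
by apply: (mulfI C0); rewrite E' mulrCA mulrA mulrVK ?unitfE // mulrC.
Qed.

(** * Young diagrams as lists, and products over their cells *)

Lemma count_sorted_geq (Y : seq nat) (i c : nat) :
  sorted geq Y -> (i < count (leq c.+1) Y)%N = (c < nth 0%N Y i)%N.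
Proof.
have geq_trans : transitive geq by move=> x y z /= xy yz; exact: leq_trans yz xy.
elim: Y i => [|x Y IH] i; first by rewrite nth_nil.
rewrite /= => xY; have sY := path_sorted xY.
have /allP Yx := order_path_min geq_trans xY.
case: (ltnP c x) => [cx|xc]; first by case: i => [|i] /=; rewrite ?cx // add1n ltnS IH.
have -> : count (leq c.+1) Y = 0%N.
  apply/eqP; rewrite eqn0Ngt -has_count; apply/hasPn => y /Yx /= yx.
  by rewrite -leqNgt (leq_trans yx).
rewrite addn0 ltn0; apply/esym/negbTE; rewrite -leqNgt; case: i => [//|i] /=.
case: (ltnP i (size Y)) => iY; last by rewrite nth_default.
by rewrite (leq_trans (Yx _ (mem_nth _ iY))).
Qed.

Section Young.
Variable K : numFieldType.
Implicit Types (Y : seq nat) (x z : K).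

Lemma size_transpose Y : size (transpose Y) = part Y 1.
Proof. by rewrite size_map size_iota. Qed.

(** Lists of parts enter the product identities through this conjugacy relation. [nth] returns 0
    past the end, so it holds for all [i] and [c]. *)
Lemma nth_transpose Y : is_young Y -> forall i c,
  (c < nth 0%N Y i)%N = (i < nth 0%N (transpose Y) c)%N.
Proof.
case/andP=> sY _ i c; case: (ltnP c (part Y 1)) => cY.
  by rewrite (nth_map 0%N) ?size_iota // nth_iota // add1n count_sorted_geq.
rewrite [nth _ (transpose Y) c]nth_default ?size_transpose // ltn0.
apply: negbTE; rewrite -leqNgt; apply: leq_trans cY.
case: i => [//|i]; rewrite leqNgt /part /= -(count_sorted_geq _ _ sY) -leqNgt.
by rewrite leqNgt -ltnS; apply/negP => h; move: (ltn_trans (ltn0Sn i) h);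
   rewrite count_sorted_geq // ltnn.
Qed.

Lemma nth_transpose_leq_size Y c : is_young Y -> (nth 0%N (transpose Y) c <= size Y)%N.
Proof.
by move=> yY; rewrite leqNgt -nth_transpose // nth_default.
Qed.

Lemma nth_leq_part1 Y i : is_young Y -> (nth 0%N Y i <= part Y 1)%N.
Proof.
move=> yY; rewrite leqNgt nth_transpose //; apply/negP => h.
by have := leq_ltn_trans (leq0n i) h; rewrite -nth_transpose ?ltnn.
Qed.

Lemma prod_cellsE Y (F : nat -> nat -> K) N : (size Y <= N)%N ->
  prod_cells Y F = \prod_(0 <= i < N) \prod_(0 <= c < nth 0%N Y i) F i.+1 c.+1.
Proof.
move=> YN; rewrite /prod_cells big_add1 /= [RHS](big_cat_nat _ YN) //=.
rewrite [X in _ = _ * X]big_nat_cond [X in _ = _ * X]big1 ?mulr1.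
  by apply: eq_bigr => i _; rewrite big_add1.
by move=> i /andP[/andP[Yi _] _]; rewrite nth_default // big_geq.
Qed.

Lemma prod_cells_transpose Y (F : nat -> nat -> K) : is_young Y ->
  prod_cells (transpose Y) F = prod_cells Y (fun i j => F j i).
Proof.
move=> yY; rewrite !(prod_cellsE _ (leqnn _)) size_transpose.
rewrite (exchange_cells _ (fun i c => F c.+1 i.+1) (nth_transpose yY) (L := part Y 1)) //.
  by move=> c _; exact: nth_transpose_leq_size.
by move=> i _; exact: nth_leq_part1.
Qed.

Lemma bracket_transpose Y x : is_young Y -> bracket x (transpose Y) = nek_f Y x.
Proof.
move=> yY; rewrite /bracket prod_cells_transpose // /nek_f /prod_cells.
by apply: eq_bigr => i _; apply: eq_bigr => j _; ring.
Qed.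

Lemma prod_cellsN Y (F : nat -> nat -> K) :
  prod_cells Y (fun i j => - F i j) = (-1) ^+ sumn Y * prod_cells Y F.
Proof.
rewrite !(prod_cellsE _ (leqnn _)).
have -> : sumn Y = (\sum_(0 <= i < size Y) nth 0 Y i)%N.
  by rewrite sumnE (big_nth 0%N).
rewrite expr_sum -big_split /=; apply: eq_bigr => i _.
rewrite -[X in (-1) ^+ X]subn0 -prodr_const_nat -big_split.
by apply: eq_bigr => c _; exact/esym/mulN1r.
Qed.

Lemma bracket_nek_f Y x : bracket x Y = (-1) ^+ sumn Y * nek_f Y (- x).
Proof.
rewrite /nek_f -prod_cellsN /bracket /prod_cells.
by apply: eq_bigr => i _; apply: eq_bigr => j _; ring.
Qed.

Lemma poch_ratio x (k : nat) : (forall c : nat, x + c%:R != 0) ->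
  poch (x + 1) k / poch x k = (x + k%:R) / x.
Proof.
move=> x0; have x00 : x != 0 by have := x0 0%N; rewrite addr0.
have px0 : poch x k != 0 by apply/prodf_neq0 => i _.
apply/eqP; rewrite eqr_div // mulrC [X in _ == X]mulrC /poch.
by have := prod_nat_shift x k; rewrite !big_mkord => ->.
Qed.

(** Each quotient of Pochhammer symbols reduces to a single fraction, which turns the double product
    of (F) into the one in [hook_content]. *)
Lemma prod_poch_ratio (L : seq nat) (M : nat) (a' : nat -> nat) :
  (forall i c, (c < nth 0 L i)%N = (i < a' c)%N) -> (forall c, a' c <= M)%N ->
  (size L <= M)%N ->
  (\prod_(1 <= i < M.+1) \prod_(i.+1 <= j < M.+1)
      (poch (j%:R - i%:R + 1 : K) (part L i - part L j)
       / poch (j%:R - i%:R) (part L i - part L j)))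
  * prod_cells L (fun i j => (a' j.-1)%:R - i%:R + ((part L i)%:R - j%:R) + 1)
  = bracket M%:R L.
Proof.
move=> ca a'M LM; rewrite (prod_cellsE _ LM) /bracket (prod_cellsE _ LM).
have adec := conjugate_geq ca.
have := hook_content K ca a'M.
rewrite !big_add1 /=.
have -> : \prod_(0 <= i < M) \prod_(i.+1 <= j < M)
    ((((nth 0 L i)%:R - (nth 0 L j)%:R + j%:R - i%:R) / (j%:R - i%:R)) : K)
  = \prod_(0 <= i < M) \prod_(i.+2 <= j < M.+1)
     (poch (j%:R - i.+1%:R + 1 : K) (part L i.+1 - part L j)
       / poch (j%:R - i.+1%:R) (part L i.+1 - part L j)).
  apply: eq_bigr => i _; rewrite [RHS]big_add1 /=; apply: eq_big_nat => j /andP[ij _].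
  have x0 (c : nat) : j.+1%:R - i.+1%:R + c%:R != 0 :> K.
    by rewrite addrAC -natrD subr_eq0 eqr_nat neq_ltn; apply/orP; right; lia.
  rewrite poch_ratio // natrB /part ?adec ?(ltnW ij) //=.
  by congr (_ / _); rewrite -!natr1; ring.
have -> : \prod_(0 <= i < M) \prod_(0 <= c < nth 0 L i)
      ((nth 0 L i)%:R - c%:R + (a' c)%:R - i%:R - 1)
  = \prod_(0 <= i < M) \prod_(0 <= c < nth 0 L i)
      ((a' c.+1.-1)%:R - i.+1%:R + ((part L i.+1)%:R - c.+1%:R) + 1) :> K.
  by apply: eq_bigr => i _; apply: eq_bigr => c _; rewrite /part /= -!natr1; ring.
move=> ->.
by apply: eq_bigr => i _; apply: eq_bigr => c _; rewrite /part /= -!natr1; ring.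
Qed.
End Young.

(** * The Selberg average formula and the instanton coefficient *)

Section Factors.
Variable K : numFieldType.
Implicit Types (Y L : seq nat) (X : K).

Lemma bracket_neq0 (x : K) Y :
  (forall i c, (i < size Y)%N -> x - i%:R + c%:R != 0) -> bracket x Y != 0.
Proof.
move=> x0; rewrite /bracket (prod_cellsE _ (leqnn _)) big_seq.
elim/big_ind: _ => [|y z|i]; [exact: oner_neq0 | exact: mulf_neq0 |].
rewrite mem_index_iota => /andP[_ iY]; apply: prod_seq_neq0 => c.
by rewrite -![_.+1%:R]natr1 !addrK x0.
Qed.

Lemma bracket_nat_neq0 (m : nat) Y : (size Y <= m)%N -> bracket (m%:R : K) Y != 0.
Proof.
move=> Ym; apply: bracket_neq0 => i c iY.
by rewrite addrAC -natrD subr_eq0 eqr_nat neq_ltn; apply/orP; right; lia.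
Qed.

(** For [L] with at most [M] rows this is Weyl's dimension formula for the representation of GL(M)
    labelled by [L]. Its partner [nek_G Y Y 0] below is the product of the hook lengths. *)
Definition schur_dim L (M : nat) : K :=
  \prod_(1 <= i < M.+1) \prod_(i.+1 <= j < M.+1)
      (poch (j%:R - i%:R + 1) (part L i - part L j)
       / poch (j%:R - i%:R) (part L i - part L j)).

Lemma schur_dim_rows Y (M : nat) : is_young Y -> (size Y <= M)%N ->
  schur_dim Y M * nek_G Y Y 0 = bracket M%:R Y.
Proof.
move=> yY YM; rewrite -(prod_poch_ratio K (nth_transpose yY)) //; last first.
  by move=> c; apply: leq_trans YM; exact: nth_transpose_leq_size.
congr (_ * _); rewrite /nek_G /prod_cells.
by apply: eq_bigr => i _; apply: eq_bigr => j _; rewrite add0r.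
Qed.

Lemma schur_dim_cols Y (M : nat) : is_young Y -> (part Y 1 <= M)%N ->
  schur_dim (transpose Y) M * nek_G Y Y 0 = bracket M%:R (transpose Y).
Proof.
move=> yY YM; rewrite -(prod_poch_ratio K (a' := nth 0%N Y)) ?size_transpose //.
- congr (_ * _); rewrite prod_cells_transpose // /nek_G /prod_cells.
  by apply: eq_bigr => i _; apply: eq_bigr => j _; rewrite /part; ring.
- by move=> i c; rewrite -nth_transpose.
- by move=> c; apply: leq_trans YM; exact: nth_leq_part1.
Qed.

(** This is [prod_box] for the columns of [Y] and the rows of [Z]. The sign reverses every factor of
    [nek_G Z Y (- X)]. *)
Lemma selberg_pair Y Z X (N M : nat) : (forall m : int, X + m%:~R != 0) ->
  is_young Y -> is_young Z -> (part Y 1 <= N)%N -> (size Z <= M)%N ->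
  (\prod_(1 <= i < N.+1) \prod_(1 <= j < M.+1)
     ((X + 1 - (i + j)%:R)
      / (X + 1 + (part (transpose Y) i)%:R + (part Z j)%:R - (i + j)%:R)))
  * nek_G Y Z X * ((-1) ^+ sumn Z * nek_G Z Y (- X))
  = bracket (X - M%:R) (transpose Y) * bracket (X - N%:R) Z.
Proof.
move=> Xi yY yZ YN ZM.
have cY i c : (c < nth 0 (transpose Y) i)%N = (i < nth 0 Y c)%N.
  by rewrite -nth_transpose.
have YN' c : (nth 0 Y c <= N)%N by exact: leq_trans (nth_leq_part1 _ yY) YN.
have ZM' c : (nth 0 (transpose Z) c <= M)%N.
  exact: leq_trans (nth_transpose_leq_size _ yZ) ZM.
have YN2 : (size (transpose Y) <= N)%N by rewrite size_transpose.
have := prod_box Xi cY (nth_transpose yZ) YN' ZM'.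
rewrite /bracket (prod_cellsE _ YN2) (prod_cellsE _ ZM).
rewrite -prod_cellsN (prod_cellsE _ ZM).
have -> : nek_G Y Z X = prod_cells (transpose Y) (fun i j =>
    X + ((part (transpose Y) i)%:R - j%:R) + ((part Z j)%:R - i%:R) + 1).
  by rewrite prod_cells_transpose.
rewrite (prod_cellsE _ YN2) big_add1 /=.
move=> E; apply: (etrans _ (etrans E _)).
  congr (_ * _ * _); apply: eq_bigr => i _; rewrite ?big_add1 /=; apply: eq_bigr => c _.
  - by congr (_ / _); rewrite /part /= natrD -!natr1; ring.
  - by rewrite /part /= -!natr1; ring.
  - by rewrite /part /= -!natr1; ring.
by congr (_ * _); apply: eq_bigr => i _; apply: eq_bigr => c _; rewrite -!natr1; ring.
Qed.
End Factors.

Lemma prod_ordered_pairs (R : comPzRingType) (n : nat) (F : 'I_n -> 'I_n -> R) :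
  \prod_t \prod_s F t s
  = (\prod_t F t t) * \prod_(t < n) \prod_(s < n | (t < s)%N) (F t s * F s t).
Proof.
transitivity (\prod_(t < n) (F t t * ((\prod_(s < n | (t < s)%N) F t s)
                                * \prod_(s < n | (s < t)%N) F t s))).
  apply: eq_bigr => t _; rewrite (bigD1 t) //=; congr (_ * _).
  rewrite (bigID (fun s : 'I_n => (t < s)%N)) /=; congr (_ * _); apply: eq_bigl => s;
    by rewrite -val_eqE /=; case: ltngtP.
rewrite big_split /=; congr (_ * _).
under [RHS]eq_bigr do rewrite big_split.
rewrite !big_split /=; congr (_ * _).
by rewrite (exchange_big_dep xpredT).
Qed.

Lemma lab_ord (T : nmodType) (n : nat) (x : 'I_n -> T) (a : 'I_n) : lab x a.+1 = x a.
Proof. by rewrite /lab valK. Qed.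

Lemma lab_out (T : nmodType) (n : nat) (x : 'I_n -> T) : lab x n.+1 = 0.
Proof. by rewrite /lab insubF // ltnn. Qed.

Section SelbergInst.
Variables (K : numFieldType) (n : nat) (N : 'I_n -> nat) (u v : 'I_n -> K).
Variables (a mu : 'I_n.+1 -> K) (Y : 'I_n.+1 -> seq nat).
Hypothesis dict : dictionary N u v a mu.
Hypothesis a_nonint : forall t s, t != s -> forall m : int, a t - a s + m%:~R != 0.
Hypothesis Y_young : forall s, is_young (Y s).
Hypothesis Y_fits : fits N Y.

Let fits_cols (s : 'I_n.+1) : (s < n)%N -> (part (Y s) 1 <= lab N s.+1)%N.
Proof.
move=> sn; have [h _] := Y_fits (Ordinal sn).
rewrite (lab_ord N (Ordinal sn)); apply: leq_trans h.
by rewrite (_ : widen_ord _ _ = s) //; apply: val_inj.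
Qed.

Let fits_rows (s : 'I_n.+1) : (0 < s)%N -> (size (Y s) <= lab N s)%N.
Proof.
case: s => [[|s] sn] // _; have [_ h] := Y_fits (Ordinal (sn : (s < n)%N)).
have -> : lab N (Ordinal sn) = N (Ordinal (sn : (s < n)%N)).
  exact: (lab_ord N (Ordinal (sn : (s < n)%N))).
by apply: leq_trans h; rewrite (_ : lift _ _ = Ordinal sn) //; apply: val_inj.
Qed.

Let diag (s : 'I_n.+1) : K :=
  (-1) ^+ sumn (Y s) * nek_f (Y s) (mu s + a s) / nek_G (Y s) (Y s) 0.

Let offdiag (t s : 'I_n.+1) : K :=
  nek_f (Y t) (mu s + a t) * nek_f (Y s) (mu t + a s)
  / (nek_G (Y t) (Y s) (a t - a s) * nek_G (Y s) (Y t) (a s - a t)).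

Lemma N_inst_half_pairs : N_inst_half a mu Y
  = (\prod_s diag s) * \prod_(t < n.+1) \prod_(s < n.+1 | (t < s)%N) offdiag t s.
Proof.
rewrite /N_inst_half.
rewrite (prod_ordered_pairs (fun s k => nek_f (Y s) (mu k + a s))).
rewrite (prod_ordered_pairs (fun t s => nek_G (Y t) (Y s) (a t - a s))).
rewrite mulrA -mulf_div -!prodfV; congr (_ * _).
  by rewrite -!big_split; apply: eq_bigr => s _ /=; rewrite subrr.
by rewrite -big_split; apply: eq_bigr => t _ /=; rewrite -prodfV -big_split.
Qed.

(** The bracket in the denominator is the content product of the hook-content formula; divided into
    [schur_dim] it leaves the inverse of the hook product. *)
Lemma selberg_diag (s : 'I_n.+1) (m : nat) : (s < n)%N -> m = (lab N s + lab N s.+1)%N ->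
  (-1) ^+ sumn (Y s)
  * (bracket (lab v s.+1 + (lab N s.+1)%:R - (lab N s)%:R) (transpose (Y s))
     / bracket ((lab N s.+1)%:R + (lab N s)%:R) (transpose (Y s)))
  * schur_dim K (transpose (Y s)) m = diag s.
Proof.
move=> sn mE; have -> : (lab N s.+1)%:R + (lab N s)%:R = m%:R :> K.
  by rewrite mE natrD addrC.
have pm : (part (Y s) 1 <= m)%N.
  by rewrite mE (leq_trans (fits_cols sn)) // leq_addl.
have b0 : bracket (m%:R : K) (transpose (Y s)) != 0.
  by apply: bracket_nat_neq0; rewrite size_transpose.
have E := schur_dim_cols K (Y_young s) pm.
have G0 : nek_G (Y s) (Y s) (0 : K) != 0.
  by apply: contraNneq b0 => G0; rewrite -E G0 mulr0.
rewrite /diag -(dict.1 s) bracket_transpose //.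
move: b0; rewrite -E => b0.
have S0 : schur_dim K (transpose (Y s)) m != 0.
  by apply: contraNneq b0 => ->; rewrite mul0r.
by field; rewrite S0 G0.
Qed.

(** At the label [n+1] both [v] and [N] vanish, so the dictionary reads [mu s + a s = - N_n], and
    the content product is the [nek_f] factor up to the sign. *)
Lemma selberg_diag_last (s : 'I_n.+1) : s = n :> nat -> (0 < n)%N ->
  schur_dim K (Y s) (lab N n) = diag s.
Proof.
move=> sn n0; have pm : (size (Y s) <= lab N n)%N by move: (@fits_rows s); rewrite sn; apply.
have b0 := bracket_nat_neq0 K pm.
have E := schur_dim_rows K (Y_young s) pm.
have G0 : nek_G (Y s) (Y s) (0 : K) != 0.
  by apply: contraNneq b0 => G0; rewrite -E G0 mulr0.
rewrite /diag dict.1 sn !lab_out addr0 add0r -(opprK (lab N n)%:R) opprK.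
apply: (mulIf G0); rewrite divfK // E bracket_nek_f.
by [].
Qed.

(** In the labels of (F), the brackets in the denominators are taken at [X - N_{s-1}] and [X - N_t],
    as in [selberg_pair]; they cancel and leave the two [nek_G]. The sign cancels against the one
    from writing the second numerator as [nek_f]. *)
Lemma selberg_offdiag (t s : 'I_n.+1) : (t < s)%N ->
  let X := X_ N u v t.+1 s.+1 in
  (bracket (lab v t.+1 + \sum_(t.+1 <= k < s.+1) lab u k
            + (lab N t.+1)%:R - (lab N t)%:R) (transpose (Y t))
     / bracket (lab v t.+1 - lab v s.+1 + \sum_(t.+1 <= k < s.+1) lab u k
         + (lab N t.+1)%:R - (lab N t)%:R - (lab N s.+1)%:R) (transpose (Y t)))
  * (bracket (- lab v s.+1 + \sum_(t.+1 <= k < s.+1) lab u k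
            - (lab N s.+1)%:R + (lab N s)%:R) (Y s)
     / bracket (lab v t.+1 - lab v s.+1 + \sum_(t.+1 <= k < s.+1) lab u k
            - (lab N t)%:R - (lab N s.+1)%:R + (lab N s)%:R) (Y s))
  * \prod_(1 <= i < (lab N t.+1).+1) \prod_(1 <= j < (lab N s).+1)
      ((X + 1 - (i + j)%:R)
       / (X + 1 + (part (transpose (Y t)) i)%:R + (part (Y s) j)%:R - (i + j)%:R))
  = offdiag t s.
Proof.
move=> ts X; have [aE muE muE'] := dict.2 t s ts.
have tn : (t < n)%N by rewrite (leq_trans ts) // -ltnS ltn_ord.
have s0 : (0 < s)%N by rewrite (leq_ltn_trans _ ts).
have Xi (m : int) : X + m%:~R != 0 by rewrite /X -aE a_nonint // neq_ltn ts.
have P := selberg_pair Xi (Y_young t) (Y_young s) (fits_cols tn) (fits_rows s0).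
move: P; set PP := (\prod_(1 <= i < _) _) => P.
rewrite bracket_transpose // -muE.
have -> : - lab v s.+1 + \sum_(t.+1 <= k < s.+1) lab u k - (lab N s.+1)%:R
          + (lab N s)%:R = - (mu t + a s) by rewrite muE'; ring.
rewrite (bracket_nek_f (Y s) (- _)) opprK.
have -> : lab v t.+1 - lab v s.+1 + \sum_(t.+1 <= k < s.+1) lab u k
         + (lab N t.+1)%:R - (lab N t)%:R - (lab N s.+1)%:R = X - (lab N s)%:R.
  by rewrite /X /X_; ring.
have -> : lab v t.+1 - lab v s.+1 + \sum_(t.+1 <= k < s.+1) lab u k
    - (lab N t)%:R - (lab N s.+1)%:R + (lab N s)%:R = X - (lab N t.+1)%:R.
  by rewrite /X /X_; ring.
have b1 : bracket (X - (lab N s)%:R) (transpose (Y t)) != 0.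
  apply: bracket_neq0 => i c _.
  by apply: (add_int_neq0 Xi (m := c%:Z - i%:Z - (lab N s)%:Z)); ring.
have b2 : bracket (X - (lab N t.+1)%:R) (Y s) != 0.
  apply: bracket_neq0 => i c _.
  by apply: (add_int_neq0 Xi (m := c%:Z - i%:Z - (lab N t.+1)%:Z)); ring.
rewrite /offdiag -(opprB (a t)) aE -/X.
(* The factors [nek_G] are nonzero because they divide the nonzero product of the two brackets. *)
have := mulf_neq0 b1 b2; rewrite -P !mulf_eq0 !negb_or => /andP[/andP[P0 G1]].
move=> /andP[sg G2].
move: b1 b2 P sg G1 G2.
move: (bracket _ _) (bracket _ _) (nek_G _ _ _) (nek_G _ _ _) (_ ^+ _) (nek_f _ _) (nek_f _ _).
move=> B2 B1 G2 G1 e f2 f1 b1 b2 P e0 g1 g2.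
have -> : PP = B1 * B2 / (G1 * (e * G2)) by rewrite -P; field; rewrite g1 g2 e0.

by field; rewrite g1 g2 e0 b1 b2.
Qed.

Lemma selberg_rhs_inst : (0 < n)%N -> selberg_rhs N u v Y = N_inst_half a mu Y.
Proof.
move=> n0; rewrite N_inst_half_pairs big_ord_recr /=.
rewrite -(selberg_diag_last (s := ord_max)) //; congr (_ * _ * _).
- rewrite big_add1 big_mkord; apply: eq_bigr => i _.
  have -> : inord i.+1.-1 = widen_ord (leqnSn n) i.
    by apply: val_inj; rewrite /= inordK // ltnW // ltnS ltn_ord.
  exact: (selberg_diag (s := widen_ord (leqnSn n) i) (ltn_ord i) erefl).
- rewrite (_ : inord n.+1.-1 = ord_max) //.
  by apply: val_inj; rewrite /= inordK.
rewrite big_add1 big_mkord; apply: eq_bigr => t _.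
rewrite big_add1 /= (big_nat_widenl _ 0) // big_mkord; apply: eq_big => [s|s /= ts].
  by rewrite andTb.
by rewrite !inord_val -selberg_offdiag.
Qed.
End SelbergInst.

(** * Rational continuation *)

Section Polyfun.
Variables (K : fieldType) (T I : Type) (X : I -> T -> K).
Local Notation poly_on := (polyfun X).

Lemma polyfun_eq f g : (forall t, f t = g t) -> poly_on f -> poly_on g.
Proof. by move=> /funext->. Qed.

Lemma polyfun_opp f : poly_on f -> poly_on (fun t => - f t).
Proof.
move=> pf; apply: (@polyfun_eq (fun t => -1 * f t)) => [t|]; first by rewrite mulN1r.
by apply: polyfun_mul => //; exact: polyfun_cst.
Qed.

Lemma polyfun_sub f g : poly_on f -> poly_on g -> poly_on (fun t => f t - g t).
Proof. by move=> pf pg; apply: polyfun_add => //; exact: polyfun_opp. Qed.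

Lemma polyfun_prod (J : Type) (r : seq J) (P : pred J) (F : J -> T -> K) :
  (forall j, poly_on (F j)) -> poly_on (fun t => \prod_(j <- r | P j) F j t).
Proof.
move=> pF; elim: r => [|j r IHr].
  by apply: (@polyfun_eq (fun=> 1)) => [t|]; [rewrite big_nil | exact: polyfun_cst].
case: (boolP (P j)) => Pj.
  apply: (@polyfun_eq (fun t => F j t * \prod_(j <- r | P j) F j t)) => [t|].
    by rewrite big_cons Pj.
  exact: polyfun_mul.
by apply: polyfun_eq IHr => t; rewrite big_cons (negbTE Pj).
Qed.

Lemma polyfun_sum (J : Type) (r : seq J) (P : pred J) (F : J -> T -> K) :
  (forall j, poly_on (F j)) -> poly_on (fun t => \sum_(j <- r | P j) F j t).
Proof.
move=> pF; elim: r => [|j r IHr].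
  by apply: (@polyfun_eq (fun=> 0)) => [t|]; [rewrite big_nil | exact: polyfun_cst].
case: (boolP (P j)) => Pj.
  apply: (@polyfun_eq (fun t => F j t + \sum_(j <- r | P j) F j t)) => [t|].
    by rewrite big_cons Pj.
  exact: polyfun_add.
by apply: polyfun_eq IHr => t; rewrite big_cons (negbTE Pj).
Qed.

Lemma polyfun_exp f k : poly_on f -> poly_on (fun t => f t ^+ k).
Proof.
move=> pf; elim: k => [|k IHk]; first exact: polyfun_cst.
apply: (@polyfun_eq (fun t => f t * f t ^+ k)) => [t|]; first by rewrite exprS.
exact: polyfun_mul.
Qed.

Lemma polyfun_comp (T' I' : Type) (X' : I' -> T' -> K) (h : T' -> T) f :
  (forall i, polyfun X' (fun t => X i (h t))) ->
  poly_on f -> polyfun X' (fun t => f (h t)).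
Proof.
move=> pX; elim=> {f} [c|i|f g _ pf _ pg|f g _ pf _ pg].
- exact: polyfun_cst.
- exact: pX.
- exact: polyfun_add.
- exact: polyfun_mul.
Qed.
End Polyfun.

Section LinePolynomials.
Variable K : numFieldType.
Local Notation line := (fun (_ : unit) (t : nat) => t%:R : K).

Lemma polyfun_line f : polyfun line f -> exists p : {poly K}, forall t, f t = p.[t%:R].
Proof.
elim=> {f} [c|i|f g _ [p Ep] _ [q Eq]|f g _ [p Ep] _ [q Eq]].
- by exists c%:P => t; rewrite hornerC.
- by exists 'X => t; rewrite hornerX.
- by exists (p + q) => t; rewrite hornerD Ep Eq.
- by exists (p * q) => t; rewrite hornerM Ep Eq.
Qed.

(** In characteristic 0 the numbers [L], [L + 1], ... are more distinct roots than the degree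
    allows. *)
Lemma polyfun_line_eq0 f (L : nat) : polyfun line f ->
  (forall t, (L <= t)%N -> f t = 0) -> forall t, f t = 0.
Proof.
move=> /polyfun_line[p Ep] f0 t; rewrite Ep.
suff -> : p = 0 by rewrite horner0.
apply/eqP; apply/negPn/negP => p0.
have /(_ [seq i%:R | i <- iota L (size p)]) := max_poly_roots p0.
rewrite size_map size_iota ltnn => h; suff: false by []; apply: h.
  by rewrite all_map; apply/allP => i; rewrite mem_iota /= /root -Ep => /andP[Li _]; rewrite f0.
by rewrite map_inj_uniq ?iota_uniq //; exact: mulrIn (oner_neq0 K).
Qed.

Lemma polyfun_prod_cells (T I : Type) (X : I -> T -> K) Y (F : nat -> nat -> T -> K) :
  (forall i j, polyfun X (F i j)) -> polyfun X (fun t => prod_cells Y (fun i j => F i j t)).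
Proof. by move=> pF; apply: polyfun_prod => i; apply: polyfun_prod => j. Qed.

Lemma polyfun_nek_f (T I : Type) (X : I -> T -> K) Y f :
  polyfun X f -> polyfun X (fun t => nek_f Y (f t)).
Proof.
move=> pf; apply: polyfun_prod_cells => i j.
apply: polyfun_sub; last exact: polyfun_cst.
by apply: polyfun_add; last exact: polyfun_cst.
Qed.

Lemma polyfun_nek_G (T I : Type) (X : I -> T -> K) Y Z f :
  polyfun X f -> polyfun X (fun t => nek_G Y Z (f t)).
Proof.
move=> pf; apply: polyfun_prod_cells => i j.
by do 3 (apply: polyfun_add; last exact: polyfun_cst).
Qed.

(* The point [N + t (1, .., 1)] fits any given diagrams for large [t], and
   N_1, .., N_n only enter the dictionary through the vacuum parameters. *)
Lemma rational_value_inst (n : nat) (N : 'I_n -> nat) (u v : 'I_n -> K)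
    (a mu : 'I_n.+1 -> K) (Y : 'I_n.+1 -> seq nat) (z : K) :
  (0 < n)%N -> dictionary N u v a mu ->
  (forall t s, t != s -> forall m : int, a t - a s + m%:~R != 0) ->
  (forall s, is_young (Y s)) ->
  (forall t s, nek_G (Y t) (Y s) (a t - a s) != 0) ->
  rational_value (fun (b : 'I_n) (M : 'I_n -> nat) => (M b)%:R : K)
    (fun M => fits M Y) (fun M => selberg_rhs M u v Y) N z ->
  z = N_inst_half a mu Y.
Proof.
move=> n0 [dict1 dict2] a_nonint yY G0 [P [Q [pP pQ Q0 -> PQ]]].
pose M t := fun b : 'I_n => (N b + t)%N.
pose l k : nat := lab (fun _ : 'I_n => 1%N) k.
(* [c] is 1 at the first label, -1 at the last and 0 elsewhere: along the line only the first and
   the last vacuum parameters move, while the masses stay fixed. *)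
pose c (s : 'I_n.+1) : int := (l s.+1)%:Z - (l s)%:Z.
pose at_ t := fun s : 'I_n.+1 => a s + t%:R * (c s)%:~R : K.
have labM t k : (lab (M t) k)%:R = (lab N k)%:R + t%:R * (l k)%:R :> K.
  rewrite /l; case: k => [|k]; first by rewrite /= mulr0 addr0.
  by rewrite /lab; case: insubP => [b _ _|_] /=; rewrite ?natrD ?mulr1 ?mulr0 ?addr0.
have dictM t : dictionary (M t) u v (at_ t) mu.
  split=> [s|s' s s's].
    by rewrite !labM addrA dict1 /c; ring.
  have [E1 E2 E3] := dict2 _ _ s's; split.
  - rewrite /X_ !labM /=.
    have -> : at_ t s' - at_ t s = a s' - a s + t%:R * ((c s')%:~R - (c s)%:~R).
      by rewrite /at_; ring.
    by rewrite E1 /X_ /c /=; ring.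
  - by rewrite !labM addrA E2 /c; ring.
  - by rewrite !labM addrA E3 /c; ring.
have M0 : M 0%N = N by apply/funext => b; exact: addn0.
have at0 : at_ 0%N = a by apply/funext => s; rewrite /at_ mul0r addr0.
pose Num t := (\prod_s (-1) ^+ sumn (Y s))
  * (\prod_s \prod_k nek_f (Y s) (mu k + at_ t s)).
pose Den t := \prod_t' \prod_s nek_G (Y t') (Y s) (at_ t t' - at_ t s).
have instE t : N_inst_half (at_ t) mu Y = Num t / Den t by [].
have pa s : polyfun line (fun t => at_ t s).
  apply: polyfun_add; first exact: polyfun_cst.
  by apply: polyfun_mul; [exact: (polyfun_var line tt) | exact: polyfun_cst].
have pM f : polyfun (fun (b : 'I_n) (M : 'I_n -> nat) => (M b)%:R : K) f ->
    polyfun line (fun t => f (M t)).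
  apply: polyfun_comp => b; apply: (@polyfun_eq _ _ _ _ (fun t => (N b)%:R + t%:R)).
    by move=> t; rewrite /M natrD.
  by apply: polyfun_add; [exact: polyfun_cst | exact: (polyfun_var line tt)].
have pNum : polyfun line Num.
  apply: polyfun_mul; first exact: polyfun_cst.
  apply: polyfun_prod => s; apply: polyfun_prod => k; apply: polyfun_nek_f.
  by apply: polyfun_add => //; exact: polyfun_cst.
have pDen : polyfun line Den.
  by apply: polyfun_prod => s; apply: polyfun_prod => k; apply/polyfun_nek_G/polyfun_sub.
(* The factors [Q (M t)] and [Den t] make [H] vanish also where a denominator does, so [H] is zero
   at every [t >= L]. *)
pose H t := Q (M t) * Den t * (P (M t) * Den t - Num t * Q (M t)).
pose L := (\max_s maxn (part (Y s) 1) (size (Y s)))%N.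
have LY s : (part (Y s) 1 <= L)%N && (size (Y s) <= L)%N.
  by rewrite -geq_max; exact: leq_bigmax.
have H0 t : H t = 0.
  have pH : polyfun line H.
    apply: polyfun_mul; first by apply: polyfun_mul => //; exact: pM.
    by apply: polyfun_sub; apply: polyfun_mul => //; exact: pM.
  apply: (polyfun_line_eq0 (L := L) pH) => {}t Lt; rewrite /H.
  have [->|QM0] := eqVneq (Q (M t)) 0; first by rewrite !mul0r.
  have [->|D0] := eqVneq (Den t) 0; first by rewrite mulr0 mul0r.
  have fM : fits (M t) Y.
    move=> b; have /andP[h1 _] := LY (widen_ord (leqnSn n) b).
    have /andP[_ h2] := LY (lift ord0 b).
    by split; rewrite (leq_trans _ (leq_addl _ _)) // (leq_trans _ Lt).
  have := PQ _ fM QM0.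
  rewrite (selberg_rhs_inst (dictM t)) //; last first.
    (* The shift changes the differences of vacuum parameters by integers only. *)
    move=> s' s s's m; have := a_nonint _ _ s's (m + t%:Z * (c s' - c s)).
    by congr (_ != 0); rewrite /at_; ring.
  by move=> /eqP; rewrite instE eqr_div // => /eqP->; rewrite subrr mulr0.
have D0 : Den 0%N != 0.
  apply/prodf_neq0 => t _; apply/prodf_neq0 => s _; rewrite at0; exact: G0.
have /eqP := H0 0%N; rewrite /H !mulf_eq0 (negbTE D0) M0 (negbTE Q0) /= subr_eq0.
by move=> /eqP E; rewrite -at0 instE; apply/eqP; rewrite eqr_div // E mulrC.
Qed.
End LinePolynomials.

(** * Nonintegrality of the differences of vacuum parameters *)

Section Vacuum.
Variables (K : numFieldType) (n : nat) (a : 'I_n.+1 -> K).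
Hypothesis G_neq0 : forall Y : 'I_n.+1 -> seq nat, (forall s, is_young (Y s)) ->
  forall t s, nek_G (Y t) (Y s) (a t - a s) != 0.

(* The cell (1,1) of the pair ((1), (m)) contributes [x + m] to [nek_G], and the
   cell (1,m+1) of the pair ((m+1), empty) contributes [x - m]. *)
Lemma vacuum_nonint t s : t != s -> forall m : int, a t - a s + m%:~R != 0.
Proof.
rewrite eq_sym => /negbTE st [m|m].
- pose Y r : seq nat := if r == t then [:: 1%N] else if m is 0 then [::] else [:: m].
  have yY r : is_young (Y r) by rewrite /Y; case: eqP => // _; case: (m).
  have := G_neq0 yY t s; rewrite /Y eqxx st /nek_G /prod_cells.
  rewrite big_nat1 big_nat1; congr (_ != 0); rewrite /part /=.
  by case: (m) => [|k] /=; rewrite -?natr1; ring.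
- pose Y r : seq nat := if r == t then [:: m.+2] else [::].
  have yY r : is_young (Y r) by rewrite /Y; case: eqP.
  have := G_neq0 yY t s; rewrite /Y eqxx st /nek_G /prod_cells.
  rewrite big_nat1 big_nat_recr // mulf_eq0 negb_or => /andP[_].
  have -> : part (transpose [:: m.+2]) m.+2 = 1%N.
    by rewrite /part /transpose (nth_map 0%N) ?size_iota // nth_iota //= add1n ltnSn.
  by rewrite NegzE; congr (_ != 0); rewrite /part /= -!natr1; ring.
Qed.
End Vacuum.

(** * Reversal of the labels *)

Lemma rev_lab_lab (T : nmodType) (n : nat) (x : 'I_n -> T) k : (k <= n.+1)%N ->
  lab (rev_lab x) k = lab x (n.+1 - k).
Proof.
case: k => [|k]; first by rewrite subn0 lab_out.
rewrite ltnS leq_eqVlt => /predU1P[->|kn]; first by rewrite lab_out subnn.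
rewrite (lab_ord (rev_lab x) (Ordinal kn)) /rev_lab -lab_ord subSS.
by rewrite [nat_of_ord _]/= subnSK.
Qed.

Lemma N_inst_half_rev (K : fieldType) n (a mu : 'I_n.+1 -> K) (Y : 'I_n.+1 -> seq nat) :
  N_inst_half (rev_lab a) mu (fun s => Y (rev_ord s)) = N_inst_half a mu Y.
Proof.
rewrite /N_inst_half /rev_lab; congr (_ * _ / _).
- by rewrite [RHS](reindex_inj rev_ord_inj).
- by rewrite [RHS](reindex_inj rev_ord_inj).
- rewrite [RHS](reindex_inj rev_ord_inj); apply: eq_bigr => t _.
  by rewrite [RHS](reindex_inj rev_ord_inj).
Qed.

Section TodaInst.
Variable R : realType.
Local Notation C := R[i].

Lemma toda_plus_inst (n : nat) (N : 'I_n -> nat) (u v : 'I_n -> C)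
    (a mu : 'I_n.+1 -> C) (E : ((var N -> R) -> C) -> C) :
  (0 < n)%N -> selberg_formula u v E -> dictionary N u v a mu ->
  (forall Y : 'I_n.+1 -> seq nat, (forall s, is_young (Y s)) ->
     forall t s, nek_G (Y t) (Y s) (a t - a s) != 0) ->
  forall Y, (forall s, is_young (Y s)) ->
  E (toda_plus_fun v Y) = N_inst_half a mu Y.
Proof.
move=> n0 F dict G0 Y yY; apply: (rational_value_inst n0 dict _ yY _ (F Y yY)).
  exact: vacuum_nonint.
exact: G0.
Qed.

(** Reversal exchanges the labels [k] and [n + 1 - k] of the power sums, which flips the differences
    of neighbouring ones, and it turns the tail sums of [v] into initial sums. *)
Lemma rev_average_toda (n : nat) (N : 'I_n -> nat) (v : 'I_n -> C)
    (E : ((var N -> R) -> C) -> C) (Y : 'I_n.+1 -> seq nat) :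
  rev_average E (toda_plus_fun (rev_lab v) (fun s => Y (rev_ord s)))
  = E (toda_minus_fun v Y).
Proof.
rewrite /rev_average; congr E; apply/funext => y.
rewrite /toda_plus_fun /toda_minus_fun [RHS](reindex_inj rev_ord_inj).
apply: eq_bigr => s _; congr schur; apply/funext => k.
have sn : (s <= n)%N by rewrite -ltnS.
have psumE c : (c <= n.+1)%N ->
  psum (fun i : var (rev_lab N) => y (Tagged (fun a => 'I_(N a)) (tagged i))) c k
  = psum y (n.+1 - c) k.
  by move=> cn; rewrite /psum -rev_lab_lab.
have revE : nat_of_ord (rev_ord s) = (n - s)%N by [].
rewrite !psumE ?(leqW sn) // revE subSn // subSS; congr (_ - _).
rewrite big_nat_rev [RHS]big_add1 big_add1 !succnK -{1}[s : nat]add0n big_addn.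
apply: eq_big_nat => b /andP[_ bn]; rewrite rev_lab_lab; last by lia.
by congr (lab v _); lia.
Qed.
End TodaInst.

(** * Complete symmetric functions *)

Section CompleteSeries.
Variable K : numFieldType.
Implicit Types (p q f g : nat -> K).

Lemma nth_complete_rev p k i : (i <= k)%N -> (complete_rev p k)`_i = complete p (k - i).
Proof.
elim: k i => [|k IHk] [|i] //= ik; by rewrite subSS IHk.
Qed.

Lemma complete0 p : complete p 0 = 1.
Proof. by []. Qed.

Lemma completeS p k :
  k.+1%:R * complete p k.+1 = \sum_(i < k.+1) p i.+1 * complete p (k - i).
Proof.
rewrite /complete /= mulrC divfK ?pnatr_eq0 //.
by apply: eq_bigr => i _; rewrite nth_complete_rev // -ltnS.
Qed.

(** Newton's recursion determines the sequence, since [k.+1] is invertible. The bound [d] serves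
    recursions that are known only up to degree [d]. *)
Lemma complete_unique p f d : f 0%N = 1 ->
  (forall k, (k < d)%N -> k.+1%:R * f k.+1 = \sum_(i < k.+1) p i.+1 * f (k - i)%N) ->
  forall k, (k <= d)%N -> f k = complete p k.
Proof.
move=> f0 fS k; elim/ltn_ind: k => -[|k] IH kd; first by rewrite f0.
apply: (mulfI (_ : k.+1%:R != 0)); first by rewrite pnatr_eq0.
rewrite fS // completeS; apply: eq_bigr => i _; rewrite IH //.
  by rewrite ltnS leq_subr.
by rewrite (leq_trans (leq_subr _ _)) // ltnW.
Qed.

Lemma eq_complete p q d : (forall i, (i < d)%N -> p i.+1 = q i.+1) ->
  complete p d = complete q d.
Proof.
move=> pq; apply: (complete_unique (d := d)) => // k kd; rewrite completeS.
by apply: eq_bigr => i _; rewrite pq // (leq_trans _ kd).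
Qed.

(** Power series are cut to polynomials so that the ring laws and the derivative of a product come
    from [{poly K}]. *)
Definition trunc f d : {poly K} := \poly_(i < d.+1) f i.

Lemma coef_trunc f d k : (k <= d)%N -> (trunc f d)`_k = f k.
Proof. by move=> kd; rewrite coef_poly ltnS kd. Qed.

Lemma coefM_eq (P P' Q Q' : {poly K}) k :
  (forall i, (i <= k)%N -> P`_i = P'`_i) -> (forall i, (i <= k)%N -> Q`_i = Q'`_i) ->
  (P * Q)`_k = (P' * Q')`_k.
Proof.
move=> PP QQ; rewrite !coefM; apply: eq_bigr => i _.
by rewrite PP ?QQ ?leq_subr // -ltnS.
Qed.

Lemma coefM_fps (P Q : {poly K}) f g k :
  (forall i, (i <= k)%N -> P`_i = f i) -> (forall i, (i <= k)%N -> Q`_i = g i) ->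
  (P * Q)`_k = fps_mul f g k.
Proof.
move=> Pf Qg; rewrite coefM; apply: eq_bigr => i _.
by rewrite Pf ?Qg ?leq_subr // -ltnS.
Qed.

Lemma fps_mul_trunc f g d k : (k <= d)%N -> fps_mul f g k = (trunc f d * trunc g d)`_k.
Proof.
by move=> kd; rewrite (coefM_fps (f := f) (g := g)) // => i ik;
   rewrite coef_trunc // (leq_trans ik).
Qed.

Lemma fps_mulA f g h : fps_mul f (fps_mul g h) =1 fps_mul (fps_mul f g) h.
Proof.
move=> d; transitivity ((trunc f d * (trunc g d * trunc h d))`_d).
  symmetry; apply: coefM_fps => i id; first by rewrite coef_trunc.
  by rewrite -fps_mul_trunc.
rewrite mulrA; apply: coefM_fps => i id; last by rewrite coef_trunc.
by rewrite -fps_mul_trunc.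
Qed.

Lemma fps_mulC f g : fps_mul f g =1 fps_mul g f.
Proof. by move=> d; rewrite !(fps_mul_trunc _ _ (leqnn d)) mulrC. Qed.

Lemma fps_mul1 f : fps_mul (@fps_one K) f =1 f.
Proof.
move=> d; rewrite /fps_mul big_ord_recl /= subn0 mul1r big1 ?addr0 // => i _.
by rewrite /fps_one /= mul0r.
Qed.

(** [complete p] is the series exp(sum_k p_k q^k / k), so this is the addition rule of the
    exponential. Newton's recursion for the product follows from Leibniz's rule. *)
Lemma completeD p q : complete (fun k => p k + q k) =1 fps_mul (complete p) (complete q).
Proof.
move=> d; symmetry; apply: (complete_unique (d := d)) => // [|k kd].
  by rewrite /fps_mul big_ord1 !complete0 mulr1.
pose F := trunc (complete p) d; pose G := trunc (complete q) d.
pose P := trunc (fun i => p i.+1) d; pose Q := trunc (fun i => q i.+1) d.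
(* Newton's identity as a differential equation: the logarithmic derivative of [complete r] is the
   series with coefficients [r i.+1]. *)
have dF r i : (i <= k)%N ->
    (trunc (complete r) d)^`()`_i = (trunc (fun i => r i.+1) d * trunc (complete r) d)`_i.
  move=> ik; rewrite coef_deriv coef_trunc ?(leq_trans _ kd) // -mulr_natl completeS coefM.
  by apply: eq_bigr => j _; rewrite !coef_trunc //; move: (ltn_ord j); lia.
have -> : k.+1%:R * fps_mul (complete p) (complete q) k.+1 = ((F * G)^`())`_k.
  by rewrite coef_deriv -fps_mul_trunc // mulr_natl.
rewrite derivM coefD.
have -> : (F^`() * G)`_k = (P * F * G)`_k by apply: coefM_eq => //; exact: (dF p).
have -> : (F * G^`())`_k = (F * (Q * G))`_k by apply: coefM_eq => //; exact: (dF q).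
rewrite -coefD (_ : P * F * G + F * (Q * G) = (P + Q) * (F * G)); last by ring.
rewrite coefM; apply: eq_bigr => i _.
rewrite coefD !coef_trunc; [|by move: (ltn_ord i); lia..].
by rewrite -fps_mul_trunc //; move: (ltn_ord i); lia.
Qed.

Lemma complete_cst0 : complete (fun=> 0 : K) =1 @fps_one K.
Proof.
move=> d; symmetry; apply: (complete_unique (d := d)) => // k _.
by rewrite /fps_one /= mulr0 big1 // => i _; rewrite mul0r.
Qed.

Lemma fps_binom_complete z c : fps_binom z c =1 complete (fun k => - (c * z ^+ k) : K).
Proof.
have bS k : k.+1%:R * fps_binom z c k.+1 = (c - k%:R) * - z * fps_binom z c k.
  rewrite /fps_binom big_ord_recr /= factS natrM exprS invfM.
  have h : k.+1%:R != 0 :> K by rewrite pnatr_eq0.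
  rewrite (_ : forall x y w : K, k.+1%:R * (x * y * (k.+1%:R^-1 * w) * (- z * (- z) ^+ k))
     = k.+1%:R * k.+1%:R^-1 * (y * - z * (x * w * (- z) ^+ k))).
    by rewrite mulfV ?mul1r.
  by move=> x y w; ring.
move=> d; apply: (complete_unique (d := d)) => // [|k _].
  by rewrite /fps_binom big_ord0 expr0 fact0 divr1 mulr1.
(* Apart from its first term, the sum for [k.+1] is [z] times the sum for [k]; the binomial
   coefficients obey the same two-term recursion. *)
rewrite bS; elim: k => [|k IHk]; first by rewrite big_ord1; ring.
rewrite big_ord_recl subn0.
transitivity (- (c * z ^+ 1) * fps_binom z c k.+1
    + z * \sum_(i < k.+1) - (c * z ^+ i.+1) * fps_binom z c (k - i)).
  by rewrite -IHk -[X in _ + _ * X]bS; ring.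
congr (_ + _); rewrite mulr_sumr; apply: eq_bigr => i _.
by rewrite /= subSS [z ^+ _.+2]exprS; ring.
Qed.

Lemma big_fps_complete (I : Type) (r : seq I) (F : I -> nat -> K) (p : I -> nat -> K) :
  (forall i, F i =1 complete (p i)) ->
  \big[@fps_mul K/@fps_one K]_(i <- r) F i =1 complete (fun k => \sum_(i <- r) p i k).
Proof.
move=> Fp; elim: r => [|i r IHr] d.
  by rewrite big_nil -complete_cst0; apply: eq_complete => k _; rewrite big_nil.
rewrite big_cons (eq_complete (q := fun k => p i k + \sum_(i <- r) p i k)); last first.
  by move=> k _; rewrite big_cons.
by rewrite completeD; apply: eq_bigr => k _; rewrite Fp IHr.
Qed.

Lemma coef_prod_complete (I : Type) (r : seq I) (P : I -> {poly K}) (p : I -> nat -> K) d :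
  (forall i k, (k <= d)%N -> (P i)`_k = complete (p i) k) ->
  forall k, (k <= d)%N -> (\prod_(i <- r) P i)`_k = complete (fun k => \sum_(i <- r) p i k) k.
Proof.
move=> Pp; elim: r => [|i r IHr] k kd.
  rewrite big_nil coef1; transitivity (complete (fun=> 0 : K) k).
    by rewrite complete_cst0.
  by apply: eq_complete => j _; rewrite big_nil.
rewrite big_cons (eq_complete (q := fun k => p i k + \sum_(i <- r) p i k)); last first.
  by move=> j _; rewrite big_cons.
rewrite completeD; apply: coefM_fps => j jk; first by rewrite Pp // (leq_trans jk).
by rewrite IHr // (leq_trans jk).
Qed.
End CompleteSeries.

(** * The Cauchy identity *)

Section RowReplacement.
Variables (R : comNzRingType) (n : nat).
Implicit Types A B : 'M[R]_n.

Lemma det_replace_row A B i :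
  \det (\matrix_(l, j) (if l == i then B l j else A l j))
  = \sum_j B i j * cofactor A i j.
Proof.
rewrite (expand_det_row _ i); apply: eq_bigr => j _; rewrite mxE eqxx; congr (_ * _).
rewrite /cofactor; congr (_ * \det _); apply/matrixP => l c.
by rewrite !mxE eq_sym (negbTE (neq_lift _ _)).
Qed.

Lemma det_replace_col A B j :
  \det (\matrix_(l, c) (if c == j then B l c else A l c))
  = \sum_i B i j * cofactor A i j.
Proof.
rewrite (expand_det_col _ j); apply: eq_bigr => i _; rewrite mxE eqxx; congr (_ * _).
rewrite /cofactor; congr (_ * \det _); apply/matrixP => l c.
by rewrite !mxE eq_sym (negbTE (neq_lift _ _)).
Qed.

(** Both sides are the sum of all [B i j * cofactor A i j], the derivative of the determinant at [A]
    in the direction [B]. *)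
Lemma sum_det_replace A B :
  \sum_i \det (\matrix_(l, j) (if l == i then B l j else A l j))
  = \sum_j \det (\matrix_(l, c) (if c == j then B l c else A l c)).
Proof.
under eq_bigr do rewrite det_replace_row.
under [RHS]eq_bigr do rewrite det_replace_col.
exact: exchange_big.
Qed.
End RowReplacement.

Section JacobiTrudi.
Variable K : numFieldType.
Implicit Types (p : nat -> K) (x y k : nat).

(** The function h_{x-y}. With two separate indices, raising and lowering a row are additions, and
    negative differences need no integers. *)
Definition hdiff p x y : K := if (y <= x)%N then complete p (x - y) else 0.

Lemma hdiffDl p x y k : hdiff p (k + x) (k + y) = hdiff p x y.
Proof. by rewrite /hdiff leq_add2l subnDl. Qed.

Lemma hdiff_lt p x y : (x < y)%N -> hdiff p x y = 0.
Proof. by rewrite /hdiff ltnNge => /negbTE->. Qed.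

(** Newton's identity for h_{x-y}. The terms with [y + k.+1 > x] vanish, so one bound [D] can serve
    all entries of a matrix. *)
Lemma hdiff_newton p x y (D : nat) : (x <= D)%N ->
  (x%:R - y%:R) * hdiff p x y = \sum_(k < D) p k.+1 * hdiff p x (y + k.+1).
Proof.
move=> xD; case: (leqP x y) => [xy|yx].
  rewrite big1 => [|k _]; last by rewrite hdiff_lt ?mulr0 //; lia.
  move: xy; rewrite leq_eqVlt => /predU1P[->|xy]; first by rewrite subrr mul0r.
  by rewrite hdiff_lt // mulr0.
rewrite /hdiff (ltnW yx) -natrB ?(ltnW yx) //.
have xyS : (x - y = (x - y).-1.+1)%N by lia.
rewrite xyS completeS (big_ord_widen_cond D xpredT
  (fun i => p i.+1 * complete p ((x - y).-1 - i))); last by lia.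
rewrite big_mkcond; apply: eq_bigr => i _ /=.
have -> : (y + i.+1 <= x)%N = (i < (x - y).-1.+1)%N by lia.
case: ifP => ilt; last by rewrite mulr0.
by congr (_ * complete p _); lia.
Qed.

Lemma fps_mul_completeN p d :
  \sum_(i < d.+1) complete p i * complete (fun k => - p k) (d - i) = (d == 0%N)%:R.
Proof.
rewrite -/(fps_mul _ _ d) -completeD -[RHS]/(fps_one _ d) -complete_cst0.
by apply: eq_complete => i _; rewrite subrr.
Qed.

Definition unitri p k : 'M[K]_k := \matrix_(i < k, j < k) hdiff p j i.

Lemma det_unitri p k : \det (unitri p k) = 1.
Proof.
rewrite -det_tr det_trig; last first.
  by apply/is_trig_mxP => i j ij; rewrite !mxE hdiff_lt.
by apply: big1 => i _; rewrite !mxE /hdiff leqnn subnn.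
Qed.

Lemma hdiff_conv p q i j k : (i <= j < k)%N ->
  \sum_(t < k) hdiff p t i * hdiff q j t = fps_mul (complete p) (complete q) (j - i).
Proof.
move=> /andP[ij jk]; rewrite -(big_mkord xpredT (fun t => hdiff p t i * hdiff q j t)).
rewrite (big_cat_nat (n := i)) ?(leq_trans ij) ?(ltnW jk) //=.
rewrite big_nat big1 ?add0r => [|t /andP[_ ti]]; last by rewrite hdiff_lt ?mul0r.
rewrite (big_cat_nat (n := j.+1)) //=; last exact: leqW.
rewrite [X in _ + X]big_nat [X in _ + X]big1 ?addr0 => [|t /andP[jt _]]; last first.
  by rewrite mulrC hdiff_lt ?mul0r.
rewrite -{1}(add0n i) big_addn subSn // big_mkord; apply: eq_bigr => t _.
rewrite /hdiff leq_addl addnK (_ : t + i <= j)%N; last by move: (ltn_ord t); lia.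
by congr (_ * complete _ _); lia.
Qed.

Lemma unitri_inv p k : unitri p k *m unitri (fun k => - p k) k = 1%:M.
Proof.
apply/matrixP => i j; rewrite !mxE.
under eq_bigr do rewrite !mxE.
case: (ltnP j i) => [ji|ij].
  rewrite big1 => [|t _]; first by rewrite -val_eqE /= gtn_eqF.
  case: (ltnP t i) => ti; first by rewrite (hdiff_lt _ ti) mul0r.
  by rewrite mulrC hdiff_lt ?mul0r ?(leq_trans ji).
rewrite hdiff_conv ?ij ?ltn_ord // [LHS]fps_mul_completeN; congr (_%:R).
by rewrite -val_eqE /= subn_eq0 eqn_leq ij.
Qed.

(** The determinant is 1, so the adjugate is the inverse; the cofactors are complete functions of
    [- p]. *)
Lemma adj_unitri p k : \adj (unitri p k) = unitri (fun k => - p k) k.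
Proof.
rewrite -[LHS]mulmx1 -(unitri_inv p k) mulmxA mul_adj_mx det_unitri.
by rewrite mul1mx.
Qed.

(** Expansion along the replaced columns gives the sum over d of (k - d) h_d(-p) h_{k-d}(p).
    Newton's identity and h(p) h(-p) = 1 leave only p_k. *)
Lemma sum_replace_unitri p k : (0 < k)%N ->
  \sum_(j < k) \det (\matrix_(l < k, c < k)
     (if c == j then hdiff p (c + k) l else unitri p k l c)) = p k.
Proof.
move=> k0; pose V : 'M[K]_k := \matrix_(l, c) hdiff p (c + k) l.
transitivity (\sum_(j < k) \sum_(i < k) hdiff p (j + k) i * hdiff (fun k => - p k) i j).
  apply: eq_bigr => j _.
  transitivity (\det (\matrix_(l, c) (if c == j then V l c else unitri p k l c))).
    by congr (\det _); apply/matrixP => l c; rewrite !mxE; case: eqP.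
  rewrite det_replace_col; apply: eq_bigr => i _; rewrite mxE; congr (_ * _).
  by have := adj_unitri p k => /matrixP/(_ j i); rewrite !mxE.
transitivity (\sum_(j < k) \sum_(d < k | (d < k - j)%N)
    hdiff (fun k => - p k) d 0 * hdiff p k d).
  apply: eq_bigr => j _; have jk := ltnW (ltn_ord j).
  rewrite -(big_mkord xpredT (fun i => hdiff p (j + k) i * hdiff _ i j)).
  rewrite -(big_mkord (fun d => d < k - j)%N (fun d => hdiff _ d 0 * hdiff p k d)).
  rewrite (big_cat_nat (n := j)) //= big_nat big1 ?add0r => [|t /andP[_ tj]]; last first.
    by rewrite mulrC hdiff_lt ?mul0r.
  rewrite -{1}(add0n j) big_addn (big_nat_widen 0 (k - j) k xpredT) ?leq_subr //.
  apply: eq_bigr => t _; rewrite mulrC; congr (_ * _); last by rewrite [(t + j)%N]addnC hdiffDl.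
  by rewrite -(hdiffDl _ t 0 j) addn0 addnC.
transitivity (\sum_(d < k) hdiff (fun k => - p k) d 0 * ((k%:R - d%:R) * hdiff p k d)).
  rewrite (exchange_big_dep xpredT) //=; apply: eq_bigr => d _.
  rewrite (eq_bigl (fun j : 'I_k => (j < k - d)%N)) => [|j]; last by lia.
  rewrite -(big_ord_widen k (fun=> _)) ?leq_subr // sumr_const card_ord.
  rewrite -[LHS]mulr_natl mulrCA; congr (_ * (_ * _)).
  by rewrite natrB // ltnW.
under eq_bigr => d _ do rewrite (hdiff_newton p d (leqnn k)) mulr_sumr.
rewrite exchange_big /=.
transitivity (\sum_(e < k) p e.+1 * (k - e.+1 == 0)%N%:R).
  apply: eq_bigr => e _; have ek := ltn_ord e.
  transitivity (p e.+1 * \sum_(d < k) hdiff (fun k => - p k) d 0 * hdiff p (k - e.+1) d).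
    rewrite mulr_sumr; apply: eq_bigr => d _; rewrite mulrCA; congr (_ * (_ * _)).
    by rewrite -{1}(subnKC ek) [(d + _)%N]addnC hdiffDl.
  rewrite hdiff_conv; last by lia.
  by rewrite subn0 fps_mulC [X in _ * X]fps_mul_completeN.
case: k k0 {V} => // k _; rewrite big_ord_recr /= subnn eqxx mulr1 big1 ?add0r // => e _.
by rewrite subSS subn_eq0 leqNgt ltn_ord mulr0.
Qed.
End JacobiTrudi.

(** * Raising and lowering the rows of Jacobi-Trudi determinants *)

Section Raising.
Variable K : numFieldType.
Implicit Types (p : nat -> K) (lam : nat -> nat) (k r : nat).

Definition jacobi_trudi (m : nat) p lam : K :=
  \det (\matrix_(l < m, j < m) hdiff p (lam l + j) l).

Lemma det_block_triangular r k (A : 'M[K]_(r + k)) :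
  (forall i j, A (rshift r i) (lshift k j) = 0) ->
  \det A = \det (ulsubmx A) * \det (drsubmx A).
Proof.
move=> A0; rewrite -{1}[A]submxK (_ : dlsubmx A = 0) ?det_ublock //.
by apply/matrixP => i j; rewrite !mxE A0.
Qed.

(** Empty rows only add a unitriangular corner, so all diagrams in a sum can share one matrix
    size. *)
Lemma jacobi_trudi_pad p lam r k : (forall i, (r <= i)%N -> lam i = 0%N) ->
  jacobi_trudi (r + k) p lam = jacobi_trudi r p lam.
Proof.
move=> lam0; rewrite /jacobi_trudi det_block_triangular => [|i j]; last first.
  by rewrite mxE hdiff_lt //= lam0 ?leq_addr // add0n ltn_addr.
rewrite (_ : ulsubmx _ = \matrix_(l < r, j < r) hdiff p (lam l + j) l); last first.
  by apply/matrixP => i j; rewrite !mxE.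
rewrite (_ : drsubmx _ = unitri p k) ?det_unitri ?mulr1 //.
by apply/matrixP => i j; rewrite !mxE /= lam0 ?leq_addr // add0n hdiffDl.
Qed.

(* Summing over the shifted row is summing over the shifted column.  A shifted
   column repeats a later one unless it is among the last [k], where the matrix
   is block triangular with unitriangular corner. *)
Lemma jacobi_trudi_raise p lam r k : (0 < k)%N -> (forall i, (r <= i)%N -> lam i = 0%N) ->
  \sum_(i < r + k) \det (\matrix_(l < r + k, j < r + k)
     hdiff p (lam l + j + (l == i) * k) l) = p k * jacobi_trudi (r + k) p lam.
Proof.
move=> k0 lam0.
pose A : 'M[K]_(r + k) := \matrix_(l, j) hdiff p (lam l + j) l.
pose B : 'M[K]_(r + k) := \matrix_(l, j) hdiff p (lam l + j + k) l.
transitivity (\sum_i \det (\matrix_(l, j) (if l == i then B l j else A l j))).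
  apply: eq_bigr => i _; congr (\det _); apply/matrixP => l j; rewrite !mxE.
  by case: eqP => _; rewrite ?mul1n ?mul0n ?addn0.
rewrite sum_det_replace big_split_ord /= big1 ?add0r => [|j _]; last first.
  have jk : (j + k < r + k)%N by rewrite ltn_add2r.
  have neq : lshift k j != Ordinal jk by rewrite -val_eqE /= neq_ltn -{1}(addn0 j) ltn_add2l k0.
  rewrite -det_tr; apply: (determinant_alternate neq) => l; rewrite !mxE eqxx.
  by rewrite eq_sym (negbTE neq) /= addnA.
rewrite jacobi_trudi_pad // mulrC -(sum_replace_unitri p k0) mulr_sumr.
apply: eq_bigr => j _; rewrite det_block_triangular => [|i c]; last first.
  rewrite !mxE (_ : (lshift k c == rshift r j) = false); last first.
    by apply/negbTE; rewrite -val_eqE /= neq_ltn (leq_trans (ltn_ord c)) ?leq_addr.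
  by rewrite hdiff_lt //= lam0 ?leq_addr // add0n ltn_addr.
rewrite /jacobi_trudi; congr (_ * _); congr (\det _); apply/matrixP => i c; rewrite !mxE.
  rewrite (_ : (lshift k c == rshift r j) = false) //.
  by apply/negbTE; rewrite -val_eqE /= neq_ltn (leq_trans (ltn_ord c)) ?leq_addr.
rewrite (inj_eq (@rshift_inj _ _)) /= lam0 ?leq_addr // !add0n.
by rewrite -addnA !hdiffDl.
Qed.

Lemma schur_jacobi_trudi p (Y : seq nat) m : (size Y <= m)%N ->
  schur Y p = jacobi_trudi m p (nth 0%N Y).
Proof.
move=> /subnKC <-; rewrite jacobi_trudi_pad // => i Yi.
by rewrite nth_default.
Qed.

(** Lowering acts as Euler's operator. In the Leibniz term of a permutation [s], Newton's identity
    multiplies the factor of row [i] by its degree [b i + s i - y], and for every [s] these degrees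
    add up to [e]. *)
Lemma det_hdiff_euler (m D e y : nat) p (b : 'I_m -> nat) :
  (forall i j : 'I_m, b i + j <= D)%N ->
  (\sum_i b i + \sum_(j < m) j = e + m * y)%N ->
  \sum_(k < D) p k.+1 * \sum_(i < m) \det (\matrix_(l < m, j < m)
      hdiff p (b l + j) (y + (l == i) * k.+1))
  = e%:R * \det (\matrix_(l < m, j < m) hdiff p (b l + j) y).
Proof.
move=> bD be; rewrite /determinant mulr_sumr.
under eq_bigr do rewrite exchange_big mulr_sumr /=.
rewrite exchange_big /=; apply: eq_bigr => s _.
under eq_bigr do rewrite -mulr_sumr mulrCA.
rewrite -mulr_sumr mulrCA; congr (_ * _).
under [LHS]eq_bigr do rewrite mulr_sumr.
rewrite exchange_big /=.
under [in RHS]eq_bigr do rewrite mxE.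
have -> : e%:R = \sum_(i < m) ((b i + s i)%:R - y%:R) :> K.
  have sE : (\sum_(j < m) s j = \sum_(j < m) j)%N by rewrite [RHS](reindex_perm s).
  by rewrite sumrB -natr_sum big_split /= sE be sumr_const card_ord natrD natrM mulr_natl addrK.
rewrite mulr_suml; apply: eq_bigr => i _.
rewrite [\prod_(i0 < m) _](bigD1 i) //= mulrA (hdiff_newton p y (bD i (s i))) mulr_suml.
apply: eq_bigr => k _; rewrite -mulrA; congr (_ * _).
rewrite (bigD1 i) //= mxE eqxx mul1n; congr (_ * _).
by apply: eq_bigr => l li; rewrite mxE (negbTE li) mul0n addn0.
Qed.
End Raising.

(** * Sums over partitions as sums over all sequences of row labels *)

Lemma geq_transitive : transitive geq.
Proof. by move=> x y z /= xy yz; exact: leq_trans yz xy. Qed.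

Lemma gtn_transitive : transitive gtn.
Proof. by move=> x y z /= xy yz; exact: ltn_trans yz xy. Qed.

Lemma gtn_sorted_gap (s : seq nat) i j :
  sorted gtn s -> (i <= j < size s)%N -> (nth 0 s j + (j - i) <= nth 0 s i)%N.
Proof.
move=> ss /andP[ij js]; rewrite -(subnKC ij) in js *; rewrite addKn.
elim: (j - i)%N js => [|k IHk] ks; first by rewrite !addn0.
rewrite addnS in ks *; have := IHk (ltnW ks).
have := sorted_ltn_nth gtn_transitive 0%N ss (i + k)%N (i + k).+1.
by rewrite !unfold_in /= ks (ltnW ks) => /(_ isT isT (ltnSn _)); lia.
Qed.

Section Symmetrization.
Variables (d : nat).
Let C := (\sum_(j < d) j)%N.
Let M := (d + C)%N.
Local Notation dtuple := (d.-tuple 'I_d.+1).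

Definition parts (r : dtuple) (l : nat) : nat := nth 0%N (map val r) l.

(** Adding the staircase makes the labels of a partition distinct, so that permutations of the rows
    act freely on them. *)
Definition stair (r : dtuple) (l : 'I_d) : nat := (parts r l + (d.-1 - l))%N.

Lemma partsE (r : dtuple) (l : 'I_d) : parts r l = tnth r l.
Proof. by rewrite /parts (nth_map ord0) ?size_tuple // (tnth_nth ord0). Qed.

Lemma sum_parts (r : dtuple) : sumn (map val r) = (\sum_(l < d) parts r l)%N.
Proof.
rewrite sumnE big_map big_tuple; apply: eq_bigr => l _; exact/esym/partsE.
Qed.

Lemma sum_rev_ord : (\sum_(l < d) (d.-1 - l) = C)%N.
Proof.
rewrite /C [RHS](reindex_inj rev_ord_inj); apply: eq_bigr => l _ /=.
by move: (ltn_ord l); lia.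
Qed.

Lemma sum_stair (r : dtuple) : (\sum_l stair r l = sumn (map val r) + C)%N.
Proof. by rewrite big_split /= sum_parts sum_rev_ord. Qed.

Lemma parts_geq (r : dtuple) i j : sorted geq (map val r) -> (i <= j < d)%N ->
  (parts r j <= parts r i)%N.
Proof.
move=> sr /andP[ij jd].
have := sorted_leq_nth geq_transitive (leqnn : reflexive geq) 0%N sr i j.
by rewrite !unfold_in /= size_map size_tuple jd (leq_ltn_trans ij) // => /(_ isT isT ij).
Qed.

Lemma stair_gt (r : dtuple) (i j : 'I_d) : sorted geq (map val r) -> (i < j)%N ->
  (stair r j < stair r i)%N.
Proof.
move=> sr ij; have := parts_geq sr (_ : i <= j < d)%N; rewrite ltnW // ltn_ord => /(_ isT).
by rewrite /stair; move: (ltn_ord j); lia.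
Qed.

Lemma stair_inj (r : dtuple) : sorted geq (map val r) -> injective (stair r).
Proof.
move=> sr i j E; apply/val_inj => /=; case: (ltngtP i j) => // /(stair_gt sr).
  by rewrite E ltnn.
by rewrite E ltnn.
Qed.

Definition stairs (r : dtuple) : seq nat := [seq stair r l | l <- enum 'I_d].

Lemma nth_stairs (r : dtuple) (l : 'I_d) : nth 0%N (stairs r) l = stair r l.
Proof. by rewrite (nth_map l) ?size_enum_ord // nth_ord_enum. Qed.

Lemma stairs_sorted (r : dtuple) : sorted geq (map val r) -> sorted gtn (stairs r).
Proof.
move=> sr; rewrite /stairs sorted_map.
apply: (sub_sorted (e := relpre val ltn)) => [i j /=|]; first exact: stair_gt.
by rewrite -sorted_map val_enum_ord iota_ltn_sorted.
Qed.

Lemma stair_image (r : dtuple) (s : 'S_d) : perm_eq [seq stair r (s l) | l <- enum 'I_d] (stairs r).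
Proof.
rewrite /stairs (map_comp (stair r) s); apply: perm_map; apply: uniq_perm.
- by rewrite map_inj_uniq ?enum_uniq //; exact: perm_inj.
- exact: enum_uniq.
by move=> l; rewrite mem_enum; apply/mapP; exists ((s^-1)%g l); rewrite ?mem_enum ?permKV.
Qed.

Lemma stair_perm_inj (r r' : dtuple) (s s' : 'S_d) :
  sorted geq (map val r) -> sorted geq (map val r') ->
  (forall l, stair r (s l) = stair r' (s' l)) -> r = r' /\ s = s'.
Proof.
move=> sr sr' E.
have Es : stairs r = stairs r'.
  apply: (irr_sorted_eq gtn_transitive) => [x|||x]; first exact: ltnn.
  - exact: stairs_sorted.
  - exact: stairs_sorted.
  rewrite -(perm_mem (stair_image r s)) -(perm_mem (stair_image r' s')).
  by congr (_ \in _); apply: eq_map.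
have Er : r = r'.
  apply: eq_from_tnth => l; apply: val_inj; rewrite /= -!partsE.
  by have := nth_stairs r l; rewrite Es nth_stairs /stair => /addIn.
split=> //; apply/permP => l; apply: (stair_inj sr).
by rewrite E Er.
Qed.

(** Sorting [b] decreasingly and subtracting the staircase gives the parts, which stay decreasing
    because the labels are distinct. They are at most [e <= d], hence fit the tuple type. *)
Lemma stair_perm_surj (b : 'I_d -> nat) (k e : nat) : (e <= d)%N ->
  injective b -> (\sum_l b l + k = e + C)%N ->
  exists (r : dtuple) (s : 'S_d),
    [/\ sorted geq (map val r), (sumn (map val r) + k = e)%N
      & forall l, b l = stair r (s l)].
Proof.
move=> ed bi be.
pose t := sort geq [seq b l | l <- enum 'I_d].
have pt : perm_eq t [seq b l | l <- enum 'I_d] by rewrite perm_sort.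
have szt : size t == d by rewrite size_sort size_map size_enum_ord.
have st : sorted gtn t.
  rewrite gtn_sorted_uniq_geq (perm_uniq pt) map_inj_uniq ?enum_uniq //=.
  by apply: sort_sorted => x y; exact: leq_total.
pose tt : d.-tuple nat := Tuple szt.
have [s sE] : exists s : 'S_d, forall l, b l = nth 0%N t (s l).
  have /tuple_permP[s sE] : perm_eq (map_tuple b (ord_tuple d)) tt.
    by rewrite perm_sym.
  exists s => l.
  have := congr1 (fun x => nth 0%N x l) sE.
  rewrite /= (nth_map l) ?size_enum_ord // nth_ord_enum => ->.
  by rewrite (nth_map l) ?size_enum_ord // nth_ord_enum (tnth_nth 0%N).
have gap i j : (i <= j < d)%N -> (nth 0 t j + (j - i) <= nth 0 t i)%N.
  by move=> ij; apply: gtn_sorted_gap => //; rewrite (eqP szt).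
have low (l : 'I_d) : (d.-1 - l <= nth 0 t l)%N.
  by have := gap l d.-1 (_ : _); move: (ltn_ord l) => ld; rewrite (_ : l <= d.-1 < d)%N;
    [move=> /(_ isT); lia | lia].
pose g (l : 'I_d) := (nth 0%N t l - (d.-1 - l))%N.
have sumg : (\sum_l g l + k = e)%N.
  have E1 : (\sum_l b l = \sum_(l < d) nth 0 t l)%N.
    by under eq_bigr do rewrite sE; rewrite [RHS](reindex_perm s).
  have E2 : (\sum_(l < d) nth 0 t l = \sum_l g l + C)%N.
    by rewrite -sum_rev_ord -big_split; apply: eq_bigr => l _; rewrite /= subnK.
  by move: be; rewrite E1 E2; lia.
have gd l : (g l < d.+1)%N.
  by rewrite ltnS (leq_trans _ ed) // -sumg (bigD1 l) //= -addnA leq_addr.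
pose r : dtuple := [tuple Ordinal (gd l) | l < d].
have pr (l : 'I_d) : parts r l = g l by rewrite partsE tnth_mktuple.
exists r, s; split.
- apply/(sortedP 0%N) => i; rewrite size_map size_tuple => id.
  have := pr (Ordinal id); have := pr (Ordinal (ltnW id)); rewrite /parts /= => -> ->.
  by have := gap i i.+1; rewrite leqnSn id => /(_ isT); rewrite /g /=; lia.
- by rewrite sum_parts; under eq_bigr do rewrite pr.
- by move=> l; rewrite sE /stair pr /g subnK.
Qed.

Variable K : comNzRingType.
Variable F : ('I_d -> nat) -> K.
Hypothesis F_perm : forall (s : 'S_d) b, F (fun l => b (s l)) = F b.
Hypothesis F_inj : forall b i j, i != j -> b i = b j -> F b = 0.

(** Sequences with a repeated label contribute nothing; any other one is some [stair r] composed
    with a permutation, both unique, whence the factor d!. As the total is at most [M = d + C], no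
    label is cut off. *)
Lemma sum_symmetric (k e : nat) : (e <= d)%N ->
  \sum_(b : {ffun 'I_d -> 'I_M.+1} | (\sum_l b l + k == e + C)%N) F (fun l => b l)
  = d`!%:R * \sum_(r : dtuple | sorted geq (map val r) && (sumn (map val r) + k == e)%N)
      F (stair r).
Proof.
move=> ed.
pose ok (r : dtuple) := sorted geq (map val r) && (sumn (map val r) + k == e)%N.
pose h (rs : dtuple * 'S_d) : {ffun 'I_d -> 'I_M.+1} :=
  [ffun l => inord (stair rs.1 (rs.2 l))].
have hE r s l : ok r -> h (r, s) l = stair r (s l) :> nat.
  move=> /andP[_ /eqP re]; rewrite ffunE inordK // ltnS.
  rewrite (@leq_trans (\sum_l stair r l)%N) //.
    by rewrite (bigD1 (s l)) //= leq_addr.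
  by rewrite sum_stair /M leq_add2r; lia.
pose A := [set rs : dtuple * 'S_d | ok rs.1]%SET.
have hinj : {in A &, injective h}.
  move=> [r s] [r' s']; rewrite !inE /= => okr okr' /ffunP E.
  have /andP[sr _] := okr; have /andP[sr' _] := okr'.
  have [|-> -> //] := @stair_perm_inj r r' s s' sr sr'.
  by move=> l; rewrite -!hE // E.
have split1 : \sum_(b : {ffun 'I_d -> 'I_M.+1} | (\sum_l b l + k == e + C)%N) F (fun l => b l)
  = \sum_(b in (h @: A)%SET) F (fun l => b l).
  rewrite big_mkcond [RHS]big_mkcond; apply: eq_bigr => b _.
  case: (boolP (injectiveb (fun l => b l : nat))) => [/injectiveP bi|/injectivePn[i [j ij bij]]];
    last first.
    by rewrite (F_inj ij bij) !if_same.
  suff -> : (b \in (h @: A)%SET) = (\sum_l b l + k == e + C)%N by [].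
  apply/imsetP/eqP => [[[r s]]|be].
    rewrite inE /= => okr ->; have /andP[_ /eqP <-] := okr.
    under eq_bigr do rewrite hE //.
    have -> : (\sum_l stair r (s l) = \sum_l stair r l)%N by rewrite [RHS](reindex_perm s).
    by rewrite sum_stair; lia.
  have [r [s [sr re bE]]] := stair_perm_surj ed bi be.
  have okr : ok r by rewrite /ok sr re eqxx.
  exists (r, s); first by rewrite inE.
  by apply/ffunP => l; apply: val_inj; rewrite /= (hE _ _ _ okr) -bE.
rewrite split1 big_imset //=.
rewrite (eq_bigl (fun rs => ok rs.1 && true)) => [|rs]; last by rewrite inE andbT.
rewrite -(pair_big (fun r => ok r) xpredT (fun r s => F (fun l => h (r, s) l))) /=.
rewrite mulr_sumr; apply: eq_bigr => r okr.
under eq_bigr => s _.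
  rewrite (_ : (fun l => h (r, s) l : nat) = fun l => stair r (s l)); last first.
    by apply/funext => l; exact: hE.
  rewrite F_perm; over.
by rewrite sumr_const card_Sn mulr_natl.
Qed.
End Symmetrization.

(** * Newton's recursion for sums of products of two Schur functions *)

Section Cauchy.
Variables (K : numFieldType) (d : nat).
Implicit Types (p : nat -> K) (b : 'I_d -> nat).
Let C := (\sum_(j < d) j)%N.
Let M := (d + C)%N.
Local Notation dtuple := (d.-tuple 'I_d.+1).

(** On the labels [stair r] this is the Jacobi-Trudi determinant of [r], as [d.-1] undoes the
    staircase; on arbitrary labels it is antisymmetric. *)
Definition alternant p b : K := \det (\matrix_(l < d, j < d) hdiff p (b l + j) d.-1).

Definition alternant_up p k i b : K :=
  \det (\matrix_(l < d, j < d) hdiff p (b l + j + (l == i) * k) d.-1).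

Definition alternant_down p k i b : K :=
  \det (\matrix_(l < d, j < d) hdiff p (b l + j) (d.-1 + (l == i) * k)).

Lemma alternant_perm p (s : 'S_d) b :
  alternant p (fun l => b (s l)) = (-1) ^+ s * alternant p b.
Proof.
rewrite /alternant -det_perm -det_mulmx -row_permE; congr (\det _).
by apply/matrixP => i j; rewrite !mxE.
Qed.

Lemma alternant_up_perm p k i (s : 'S_d) b :
  alternant_up p k i (fun l => b (s l)) = (-1) ^+ s * alternant_up p k (s i) b.
Proof.
rewrite /alternant_up -det_perm -det_mulmx -row_permE; congr (\det _).
by apply/matrixP => l j; rewrite !mxE (inj_eq perm_inj).
Qed.

Lemma alternant_repeat p b i j : i != j -> b i = b j -> alternant p b = 0.
Proof. by move=> ij bij; apply: (determinant_alternate ij) => l; rewrite !mxE bij. Qed.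

Lemma alternant_stair p (r : dtuple) : alternant p (stair r) = jacobi_trudi d p (parts r).
Proof.
congr (\det _); apply/matrixP => l j; rewrite !mxE /stair; have := ltn_ord l => ld.
rewrite -[in RHS](hdiffDl _ _ _ (d.-1 - l)) subnK; last by lia.
by congr hdiff; lia.
Qed.

Lemma parts_small (r : dtuple) i :
  sorted geq (map val r) -> (sumn (map val r) <= i)%N -> parts r i = 0%N.
Proof.
move=> sr ri; case: (ltnP i d) => id; last first.
  by rewrite /parts nth_default // size_map size_tuple.
apply/eqP; rewrite eqn0Ngt; apply/negP => p0.
suff : (i.+1 <= sumn (map val r))%N by rewrite ltnNge ri.
rewrite sum_parts (leq_trans (n := (\sum_(l < i.+1) 1)%N)) //.
  by rewrite sum1_card card_ord.
rewrite (big_ord_widen d (fun=> 1%N) id) big_mkcond; apply: leq_sum => l _.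
case: ifP => // li; rewrite (leq_trans p0) // parts_geq // id andbT.
by rewrite -ltnS.
Qed.

(** A partition of at most [d - k] has at most [d - k] nonempty rows, which leaves the [k] empty
    rows of [jacobi_trudi_raise]. *)
Lemma alternant_raise p k (r : dtuple) : (0 < k)%N -> sorted geq (map val r) ->
  (sumn (map val r) + k <= d)%N ->
  \sum_i alternant_up p k i (stair r) = p k * alternant p (stair r).
Proof.
move=> k0 sr rk; have kd : (k <= d)%N by lia.
have := @jacobi_trudi_raise K p (parts r) (d - k) k k0.
rewrite subnK // alternant_stair => <- => [|i ri]; last by apply: parts_small => //; lia.
apply: eq_bigr => i _; congr (\det _); apply/matrixP => l j; rewrite !mxE /stair.
have := ltn_ord l => ld.
rewrite -[in RHS](hdiffDl _ _ _ (d.-1 - l)) subnK; last by lia.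
by congr hdiff; lia.
Qed.

(** Substituting [b i + k] for [b i] moves the lowering of one factor to a raising of the other.
    Terms with [b i < k] vanish, since row [i] of the lowered determinant then has only negative
    indices. *)
Lemma sum_alternant_shift p q k i e : (0 < k)%N -> (e <= d)%N ->
  \sum_(b : {ffun 'I_d -> 'I_M.+1} | (\sum_l b l == e + C)%N)
     alternant_down p k i (fun l => b l) * alternant q (fun l => b l)
  = \sum_(b : {ffun 'I_d -> 'I_M.+1} | (\sum_l b l + k == e + C)%N)
     alternant p (fun l => b l) * alternant_up q k i (fun l => b l).
Proof.
move=> k0 ed; rewrite (bigID (fun b : {ffun 'I_d -> 'I_M.+1} => (k <= b i)%N)) /=.
rewrite [X in _ + X]big1 ?addr0 => [|b /andP[_ bik]]; last first.
  rewrite /alternant_down (expand_det_row _ i) big1 ?mul0r // => j _.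
  rewrite mxE eqxx mul1n hdiff_lt ?mul0r //; move: (ltn_ord j); lia.
pose up (b : {ffun 'I_d -> 'I_M.+1}) : {ffun 'I_d -> 'I_M.+1} :=
  [ffun l => inord (b l + (l == i) * k)].
pose dn (b : {ffun 'I_d -> 'I_M.+1}) : {ffun 'I_d -> 'I_M.+1} :=
  [ffun l => inord (b l - (l == i) * k)].
have dnE (b : {ffun 'I_d -> 'I_M.+1}) l : dn b l = (b l - (l == i) * k)%N :> nat.
  by rewrite ffunE inordK // (leq_ltn_trans (leq_subr _ _)).
rewrite (reindex_onto up dn) /= => [|b /andP[_ bk]]; last first.
  apply/ffunP => l; apply: val_inj; rewrite ffunE dnE subnK ?inord_val //.
  by case: eqP => [->|_]; rewrite ?mul1n ?mul0n.
have sumU (b : {ffun 'I_d -> 'I_M.+1}) :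
    (\sum_l (b l + (l == i) * k) = \sum_l b l + k)%N.
  rewrite big_split /=; congr (_ + _)%N; rewrite (bigD1 i) //= eqxx mul1n big1 ?addn0 //.
  by move=> l /negbTE->.
have upE (b : {ffun 'I_d -> 'I_M.+1}) : (\sum_l b l + k <= M)%N ->
    forall l, up b l = (b l + (l == i) * k)%N :> nat.
  move=> bM l; rewrite ffunE inordK // ltnS (leq_trans _ bM) // -sumU.
  by rewrite [X in (_ <= X)%N](bigD1 l) //= leq_addr.
apply: eq_big => [b|b /andP[/andP[/eqP be kb] /eqP db]].
  apply/andP/eqP => [[/andP[/eqP be kb] /eqP db]|be].
    (* [inord] sends values above [M] to 0, which would contradict [k <= up b i] because [k] is
       positive. *)
    have bk : (b i + k <= M)%N.
      move: kb; rewrite ffunE eqxx mul1n; case: (leqP (b i + k) M) => // bM.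
      by rewrite /inord /insubd insubF ?leqn0 ?(gtn_eqF k0) // ltnS leqNgt bM.
    rewrite -be -sumU; apply: eq_bigr => l _; rewrite ffunE inordK // ltnS.
    by case: eqP => [->|_]; rewrite ?mul1n ?mul0n ?addn0 // -ltnS.
  have bM : (\sum_l b l + k <= M)%N by rewrite be leq_add2r.
  split; last first.
    by apply/eqP/ffunP => l; apply: val_inj; rewrite /= dnE upE // addnK.
  rewrite upE // eqxx mul1n leq_addl andbT; under eq_bigr do rewrite upE //.
  by rewrite sumU be.
have upl l : up b l = (b l + (l == i) * k)%N :> nat.
  rewrite -{2}db dnE subnK //; case: eqP => [->|_]; by rewrite ?mul1n ?mul0n.
congr (_ * _).
  congr (\det _); apply/matrixP => l j; rewrite !mxE upl.
  by rewrite -[RHS](hdiffDl _ _ _ ((l == i) * k)); move: ((l == i) * k)%N => x; congr hdiff; lia.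
by congr (\det _); apply/matrixP => l j; rewrite !mxE upl addnAC.
Qed.

Definition schur_sum p q e : K :=
  \sum_(r : dtuple | sorted geq (map val r) && (sumn (map val r) == e)%N)
    alternant p (stair r) * alternant q (stair r).

Lemma schur_sum_newton p q e : (e < d)%N ->
  e.+1%:R * schur_sum p q e.+1
  = \sum_(k < e.+1) (p k.+1 * q k.+1) * schur_sum p q (e - k)%N.
Proof.
move=> ed; have d0 : (d`!)%:R != 0 :> K by rewrite pnatr_eq0 -lt0n fact_gt0.
apply: (mulfI d0); rewrite mulrCA.
have sym_prod : forall b (s : 'S_d), alternant p (fun l => b (s l)) * alternant q (fun l => b (s l))
    = alternant p b * alternant q b.
  by move=> b s; rewrite !alternant_perm mulrACA -expr2 sqrr_sign mul1r.
have -> : d`!%:R * schur_sum p q e.+1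
  = \sum_(b : {ffun 'I_d -> 'I_M.+1} | (\sum_l b l == e.+1 + C)%N)
      alternant p (fun l => b l) * alternant q (fun l => b l).
  have := @sum_symmetric d K (fun b => alternant p b * alternant q b) _ _ 0 e.+1 ed.
  rewrite (_ : schur_sum p q e.+1 = \sum_(r : dtuple | sorted geq (map val r)
    && (sumn (map val r) + 0 == e.+1)%N) alternant p (stair r) * alternant q (stair r)).
    move=> <- //; first by apply: eq_bigl => b; rewrite addn0.
    by move=> b i j ij bij; rewrite (alternant_repeat _ ij bij) mul0r.
  by apply: eq_bigl => r; rewrite addn0.
(* The labels add up to [e.+1 + C] and the column indices to [C]; this matches the degree count of
   [det_hdiff_euler] with [y = d.-1]. *)
have CC : (C + C = d * d.-1)%N.
  rewrite /C -{1}(sum_rev_ord d) -big_split /= (eq_bigr (fun=> d.-1)).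
    by rewrite sum_nat_const card_ord.
  by move=> l _; move: (ltn_ord l); lia.
pose D := (M + d)%N.
transitivity (\sum_(k < D) p k.+1 * \sum_(i < d)
    \sum_(b : {ffun 'I_d -> 'I_M.+1} | (\sum_l b l == e.+1 + C)%N)
       alternant_down p k.+1 i (fun l => b l) * alternant q (fun l => b l)).
  rewrite mulr_sumr.
  under [RHS]eq_bigr do rewrite exchange_big mulr_sumr /=.
  rewrite [RHS]exchange_big /=; apply: eq_bigr => b /eqP be.
  rewrite mulrA -(@det_hdiff_euler K d D e.+1 d.-1 p (fun l => b l)) => [|l j|].
  - by rewrite mulr_suml; apply: eq_bigr => k _; rewrite -mulrA mulr_suml.
  - by move: (ltn_ord (b l)) (ltn_ord j); rewrite /D; lia.
  - by rewrite be -CC addnA.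
(* The lowering for [p] becomes a raising for [q]. Summed over [i] the summand is symmetric again,
   so the sum returns to partitions, where raising is multiplication by [q k.+1]. *)
transitivity (d`!%:R * \sum_(k < D) p k.+1 *
    \sum_(r : dtuple | sorted geq (map val r) && (sumn (map val r) + k.+1 == e.+1)%N)
       alternant p (stair r) * (q k.+1 * alternant q (stair r))).
  rewrite mulr_sumr; apply: eq_bigr => k _; rewrite mulrCA; congr (_ * _).
  under eq_bigr do rewrite sum_alternant_shift //.
  rewrite exchange_big /=; under eq_bigr do rewrite -mulr_sumr.
  rewrite (sum_symmetric (F := fun b => alternant p b * \sum_i alternant_up q k.+1 i b)) //.
  - congr (_ * _); apply: eq_bigr => r /andP[sr /eqP re].
    by rewrite alternant_raise // re.
  - move=> s b; rewrite alternant_perm; under eq_bigr do rewrite alternant_up_perm.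
    rewrite -mulr_sumr mulrACA -expr2 sqrr_sign mul1r; congr (_ * _).
    by rewrite [RHS](reindex_perm s).
  - by move=> b i j ij bij; rewrite (alternant_repeat _ ij bij) mul0r.
congr (_ * _).
have eD : (e.+1 <= D)%N by rewrite /D; lia.
rewrite (big_ord_widen D (fun k => (p k.+1 * q k.+1) * schur_sum p q (e - k)%N) eD).
rewrite [RHS]big_mkcond; apply: eq_bigr => k _; case: ifP => ke.
  rewrite -mulrA; congr (_ * _); rewrite mulr_sumr; apply: eq_big => [r|r _].
    by congr (_ && _); lia.
  by rewrite mulrCA.
by rewrite big_pred0 ?mulr0 // => r; apply/negbTE; rewrite negb_and; apply/orP; right; lia.
Qed.

(** The left side obeys Newton's recursion for the power sums [p k * q k] and starts at 1, so
    [complete_unique] applies; [d] rows suffice for partitions of [e <= d]. *)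
Lemma sum_schur_schur p q e : (e <= d)%N ->
  \sum_(r : dtuple | sorted geq (map val r) && (sumn (map val r) == e)%N)
    schur [seq k <- map val r | (0 < k)%N] p * schur [seq k <- map val r | (0 < k)%N] q
  = complete (fun k => p k * q k) e.
Proof.
have filterE (r : dtuple) : sorted geq (map val r) ->
    nth 0%N [seq k <- map val r | (0 < k)%N] =1 parts r.
  rewrite /parts; elim: (map val r) => [|x s IHs] //= xs.
  have sx := order_path_min geq_transitive xs.
  case: (posnP x) => [x0|x0] [|l] //=; last by rewrite IHs // (path_sorted xs).
    rewrite x0 in sx *; rewrite (eq_in_filter (a2 := pred0)) ?filter_pred0 // => y ys.
    by move/allP: sx => /(_ y ys) /=; rewrite leqn0 => /eqP->.
  rewrite x0 in sx *; rewrite (eq_in_filter (a2 := pred0)) ?filter_pred0 // => [|y ys].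
    by rewrite nth_nil; move/(all_nthP 0%N): sx => sx; case: (ltnP l (size s)) => ls;
      [have := sx l ls; rewrite /= leqn0 => /eqP-> | rewrite nth_default].
  by move/allP: sx => /(_ y ys) /=; rewrite leqn0 => /eqP->.
have schurE (f : nat -> K) (r : dtuple) : sorted geq (map val r) ->
    schur [seq k <- map val r | (0 < k)%N] f = alternant f (stair r).
  move=> sr; rewrite alternant_stair (@schur_jacobi_trudi K f _ d); last first.
    by rewrite size_filter (leq_trans (count_size _ _)) // size_map size_tuple.
  by congr (\det _); apply/matrixP => l j; rewrite !mxE filterE.
move=> ed; transitivity (schur_sum p q e).
  by apply: eq_bigr => r /andP[sr _]; rewrite !schurE.
apply: (complete_unique (d := d)) => // [|k kd]; last exact: schur_sum_newton.
pose r0 : dtuple := [tuple ord0 | l < d].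
have parts0 (l : nat) : parts r0 l = 0%N.
  case: (ltnP l d) => ld; first by rewrite (partsE r0 (Ordinal ld)) tnth_mktuple.
  by rewrite /parts nth_default // size_map size_tuple.
have sr0 : sorted geq (map val r0).
  apply/(sortedP 0%N) => i _; rewrite -/(parts r0 i) -/(parts r0 i.+1).
  by rewrite /= !parts0.
have sum0 : sumn (map val r0) = 0%N by rewrite sum_parts big1 // => l _; exact: parts0.
rewrite /schur_sum (bigD1 r0) /=; last by rewrite sr0 sum0.
have alt1 f : alternant f (stair r0) = 1.
  rewrite alternant_stair -(det_unitri f d); congr (\det _); apply/matrixP => l j.
  by rewrite !mxE parts0.
rewrite !alt1 mulr1 big1 ?addr0 // => r /andP[/andP[sr /eqP r0E] /negP[]].
apply/eqP/eq_from_tnth => l; rewrite tnth_mktuple; apply: val_inj.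
by rewrite /= -partsE parts_small // r0E.
Qed.
End Cauchy.

(** * Expansion of the Dotsenko-Fateev integral *)

Section PolyfunSchur.
Variables (K : numFieldType) (T I : Type) (X : I -> T -> K).

Lemma polyfun_complete (G : nat -> T -> K) k :
  (forall i, polyfun X (G i)) -> polyfun X (fun t => complete (fun i => G i t) k).
Proof.
move=> pG; elim/ltn_ind: k => -[|k] IH; first exact: polyfun_cst.
apply: (@polyfun_eq _ _ _ _ (fun t => k.+1%:R^-1 *
    \sum_(i < k.+1) G i.+1 t * complete (fun i => G i t) (k - i))) => [t|].
  by rewrite -completeS mulKf // pnatr_eq0.
apply: polyfun_mul; first exact: polyfun_cst.
apply: polyfun_sum => i; apply: polyfun_mul => //.
by apply: IH; rewrite ltnS leq_subr.
Qed.

Lemma polyfun_det m (A : T -> 'M[K]_m) :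
  (forall i j, polyfun X (fun t => A t i j)) -> polyfun X (fun t => \det (A t)).
Proof.
move=> pA; apply: polyfun_sum => s; apply: polyfun_mul; first exact: polyfun_cst.
by apply: polyfun_prod.
Qed.

Lemma polyfun_schur (G : nat -> T -> K) (Y : seq nat) :
  (forall i, polyfun X (G i)) -> polyfun X (fun t => schur Y (fun i => G i t)).
Proof.
move=> pG; apply: polyfun_det => i j.
apply: (@polyfun_eq _ _ _ _ (fun t => if (i <= part Y i.+1 + j)%N
    then complete (fun i => G i t) (part Y i.+1 + j - i) else 0)) => [t|].
  by apply/esym; exact: mxE.
by case: (_ <= _)%N; [exact: polyfun_complete | exact: polyfun_cst].
Qed.
End PolyfunSchur.

Section Toda.
Variable R : realType.
Local Notation C := R[i].

Lemma polyfun_psum n (N : 'I_n -> nat) a k :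
  polyfun (@Defs.coord R (var N)) (fun x => psum x a k).
Proof.
rewrite /psum; case: a => [|a]; first exact: polyfun_cst.
rewrite /lab; case: insubP => [b _ _|_] /=; last exact: polyfun_cst.
apply: polyfun_sum => i; apply: polyfun_exp.
exact: (polyfun_var (@Defs.coord R (var N)) (Tagged (fun a => 'I_(N a)) i)).
Qed.

Lemma polyfun_toda_plus n (N : 'I_n -> nat) (v : 'I_n -> C) Y :
  polyfun (@Defs.coord R (var N)) (toda_plus_fun v Y).
Proof.
apply: polyfun_prod => s; apply: polyfun_schur => k.
apply: polyfun_sub; last exact: polyfun_cst.
by apply: polyfun_sub; exact: polyfun_psum.
Qed.

Lemma polyfun_toda_minus n (N : 'I_n -> nat) (v : 'I_n -> C) Y :
  polyfun (@Defs.coord R (var N)) (toda_minus_fun v Y).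
Proof.
apply: polyfun_prod => s; apply: polyfun_schur => k.
apply: polyfun_sub; last exact: polyfun_cst.
by apply: polyfun_sub; exact: polyfun_psum.
Qed.

Lemma selberg_average_sum n (N : 'I_n -> nat) (u v : 'I_n -> C)
    (E : ((var N -> R) -> C) -> C) (J : Type) (r : seq J) (P : pred J)
    (c : J -> C) (F : J -> (var N -> R) -> C) :
  selberg_average u v E -> (forall j, polyfun (@Defs.coord R (var N)) (F j)) ->
  E (fun x => \sum_(j <- r | P j) c j * F j x) = \sum_(j <- r | P j) c j * E (F j).
Proof.
move=> [E1 Elin _] pF; elim: r => [|j r IHr].
  (* Linearity is given for [c * f + g], so the zero function is written as [-1 * 1 + 1]. *)
  rewrite big_nil; transitivity (E (fun x => -1 * 1 + 1)).
    by congr E; apply/funext => x; rewrite big_nil mulr1 addNr.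
  by rewrite (Elin (-1) (fun=> 1) (fun=> 1)) ?E1 ?mulr1 ?addNr //; exact: polyfun_cst.
rewrite big_cons; case: ifP => Pj; last first.
  by rewrite -IHr; congr E; apply/funext => x; rewrite big_cons Pj.
rewrite -IHr -Elin //.
  by congr E; apply/funext => x; rewrite big_cons Pj.
by apply: polyfun_sum => i; apply: polyfun_mul => //; exact: polyfun_cst.
Qed.

Lemma sum_by_parts (n : nat) (P D : nat -> C) : P 0%N = 0 -> P n.+1 = 0 ->
  \sum_(s < n.+1) (P s - P s.+1) * D s = \sum_(s < n) P s.+1 * (D s.+1 - D s).
Proof.
move=> P0 Pn; under eq_bigr do rewrite mulrBl.
rewrite sumrB big_ord_recl /= P0 mul0r add0r [X in _ - X]big_ord_recr /= Pn mul0r addr0.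
by rewrite -sumrB; apply: eq_bigr => i _; rewrite mulrBr.
Qed.

Lemma lab_sum n (q : 'I_n -> C) m : \sum_(b < n) (b.+1 == m)%:R * q b = lab q m.
Proof.
case: m => [|m]; first by rewrite big1 // => b _; rewrite mul0r.
rewrite /lab; case: insubP => [b _ bm|mn] /=.
  rewrite (bigD1 b) //= bm eqxx mul1r big1 ?addr0 // => c cb.
  by rewrite -bm eqSS (inj_eq val_inj) (negbTE cb) mul0r.
rewrite big1 // => b _; rewrite eqSS; case: eqP => [bm|]; last by rewrite mul0r.
by move: mn; rewrite -bm ltn_ord.
Qed.

Lemma cartan_sum n (q : 'I_n -> C) (a : 'I_n) :
  \sum_b cartan C a b * q b = 2%:R * lab q a.+1 - lab q a - lab q a.+2.
Proof.
rewrite -!lab_sum mulr_sumr -!sumrB; apply: eq_bigr => b _.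
rewrite /cartan !eqSS -val_eqE /= ![in RHS](eq_sym (nat_of_ord b)).
rewrite [(b.+1 == _)]eq_sym [(_ == b.+1)]eq_sym.
case: (eqVneq (a : nat) b) => [->|ab].
  by rewrite (gtn_eqF (ltnSn b)) /=; ring.
case: (eqVneq a.+1 (b : nat)) => [<-|ab1].
  by rewrite (gtn_eqF (leqnSn a.+1)) /=; ring.
by case: (b.+1 == a) => /=; ring.
Qed.

Lemma sum_var n (N : 'I_n -> nat) (f : 'I_n -> C) (x : var N -> R) k :
  \sum_i f (tag i) * (x i)%:C ^+ k
  = \sum_a f a * \sum_(i < N a) (x (Tagged (fun a => 'I_(N a)) i))%:C ^+ k.
Proof.
under [RHS]eq_bigr do rewrite mulr_sumr.
by rewrite sig_big_dep /=; apply: eq_bigr => -[a i].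
Qed.

(** The product of the constants in the arguments of the two Toda functions, summed over the labels.
    It does not depend on [k], so as a power sum it yields a power of 1 - q. *)
Definition toda_shift n (vp vm : 'I_n -> C) : C :=
  \sum_(s < n.+1) (\sum_(s.+1 <= b < n.+1) lab vp b) * (\sum_(1 <= b < s.+1) lab vm b).

(** Summation by parts turns the sum over [n+1] labels into one over the [n] simple roots. The
    Cartan matrix appears as minus the second difference, and differences of the partial sums of [v]
    give back the single [v_a]. *)
Lemma toda_exponent n (N Nt : 'I_n -> nat) (vp vm : 'I_n -> C)
    (x : var N -> R) (y : var Nt -> R) k :
  - (\sum_i vm (tag i) * (x i)%:C ^+ k + \sum_j vp (tag j) * (y j)%:C ^+ k
     + \sum_i \sum_j cartan C (tag i) (tag j) * ((x i * y j)%:C) ^+ k)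
  = \sum_(s < n.+1)
      (psum x s k - psum x s.+1 k - \sum_(s.+1 <= b < n.+1) lab vp b)
      * (psum y s.+1 k - psum y s k - \sum_(1 <= b < s.+1) lab vm b)
    - toda_shift vp vm.
Proof.
pose P a := psum x a k; pose Q a := psum y a k.
pose A s := \sum_(s.+1 <= b < n.+1) lab vp b; pose B s := \sum_(1 <= b < s.+1) lab vm b.
pose p (a : 'I_n) := \sum_(i < N a) (x (Tagged (fun a => 'I_(N a)) i))%:C ^+ k.
pose q (a : 'I_n) := \sum_(i < Nt a) (y (Tagged (fun a => 'I_(Nt a)) i))%:C ^+ k.
have [P0 Pn Q0 Qn] : [/\ P 0%N = 0, P n.+1 = 0, Q 0%N = 0 & Q n.+1 = 0].
  by rewrite /P /Q /psum !lab_out.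
have PE (a : 'I_n) : P a.+1 = p a by rewrite /P /psum lab_ord.
have QE (a : 'I_n) : Q a.+1 = q a by rewrite /Q /psum lab_ord.
have -> : \sum_(s < n.+1) (P s - P s.+1 - A s) * (Q s.+1 - Q s - B s)
  = \sum_(s < n.+1) (P s - P s.+1) * (Q s.+1 - Q s - B s)
    + \sum_(s < n.+1) (Q s - Q s.+1) * A s + toda_shift vp vm.
  have E s : (P s - P s.+1 - A s) * (Q s.+1 - Q s - B s)
    = (P s - P s.+1) * (Q s.+1 - Q s - B s) + (Q s - Q s.+1) * A s + A s * B s.
    by move: (P s) (P s.+1) (A s) (Q s.+1) (Q s) (B s) => *; ring.
  by under eq_bigr do rewrite E; rewrite !big_split.
rewrite addrK (@sum_by_parts n P (fun s => Q s.+1 - Q s - B s)) // (@sum_by_parts n Q A) //.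
rewrite (sum_var vm) (sum_var vp).
have -> : \sum_i \sum_j cartan C (tag i) (tag j) * ((x i * y j)%:C) ^+ k
  = \sum_a p a * \sum_b cartan C a b * q b.
  transitivity (\sum_i (\sum_b cartan C (tag i) b * q b) * (x i)%:C ^+ k).
    apply: eq_bigr => i _; rewrite -(sum_var (cartan C (tag i))) mulr_suml.
    apply: eq_bigr => j _; rewrite rmorphM exprMn -mulrA; congr (_ * _); exact: mulrC.
  by rewrite (sum_var (fun a => \sum_b cartan C a b * q b)); apply: eq_bigr => a _; exact: mulrC.
rewrite -!big_split -sumrN; apply: eq_bigr => a _.
have AE : A a = vp a + A a.+1 by rewrite /A big_ltn ?ltnS // lab_ord.
have BE : B a.+1 = B a + vm a by rewrite /B big_nat_recr // lab_ord.
have LE m : Q m = lab q m by [].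
rewrite AE BE cartan_sum -!LE; transitivity (P a.+1 * (Q a.+2 - Q a.+1 - (B a + vm a)
   - (Q a.+1 - Q a - B a)) + Q a.+1 * (A a.+1 - (vp a + A a.+1))); last by [].
rewrite -[\sum_(i < N a) _]/(p a) -[\sum_(i < Nt a) _]/(q a) -PE -QE.
move: (P a.+1) (Q a.+2) (Q a.+1) (Q a) (A a.+1) (B a) => p1 q2 q1 q0 a1 b0.
by rewrite -[LHS]/(- (vm a * p1 + vp a * q1 + p1 * (2%:R * q1 - q0 - q2))); ring.
Qed.

Lemma df_integrand_complete n (N Nt : 'I_n -> nat) (vp vm : 'I_n -> C)
    (x : var N -> R) (y : var Nt -> R) :
  df_integrand vp vm x y
  =1 fps_mul (complete (fun k => \sum_(s < n.+1)
      (psum x s k - psum x s.+1 k - \sum_(s.+1 <= b < n.+1) lab vp b)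
      * (psum y s.+1 k - psum y s k - \sum_(1 <= b < s.+1) lab vm b)))
    (fps_binom 1 (toda_shift vp vm)).
Proof.
move=> d.
pose F1 := \big[@fps_mul C/@fps_one C]_(i : var N) fps_binom (x i)%:C (vm (tag i)).
pose F2 := \big[@fps_mul C/@fps_one C]_(j : var Nt) fps_binom (y j)%:C (vp (tag j)).
pose F3 := \big[@fps_mul C/@fps_one C]_(i : var N)
  \big[@fps_mul C/@fps_one C]_(j : var Nt)
     fps_binom (x i * y j)%:C (cartan C (tag i) (tag j)).
rewrite -[LHS]/(fps_mul (fps_mul F1 F2) F3 d).
have E1 : F1 =1 complete (fun k => \sum_i - (vm (tag i) * (x i)%:C ^+ k)).
  by apply: big_fps_complete => i; exact: fps_binom_complete.
have E2 : F2 =1 complete (fun k => \sum_j - (vp (tag j) * (y j)%:C ^+ k)).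
  by apply: big_fps_complete => i; exact: fps_binom_complete.
have E3 : F3 =1 complete (fun k => \sum_i \sum_j
    - (cartan C (tag i) (tag j) * ((x i * y j)%:C) ^+ k)).
  apply: big_fps_complete => i; apply: big_fps_complete => j; exact: fps_binom_complete.
rewrite (funext E1) (funext E2) (funext E3) -(funext (completeD _ _)) -completeD.
rewrite (funext (fps_binom_complete _ _)) -completeD.
apply: eq_complete => k _; rewrite expr1n mulr1 -toda_exponent !sumrN.
by under [X in _ + X]eq_bigr do rewrite sumrN; rewrite sumrN !opprD.
Qed.

Definition diagrams n d (r : {ffun 'I_n.+1 -> d.-tuple 'I_d.+1}) (s : 'I_n.+1) : seq nat :=
  [seq k <- map val (r s) | (0 < k)%N].

Lemma diagrams_young n d (r : {ffun 'I_n.+1 -> d.-tuple 'I_d.+1}) s :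
  sorted geq (map val (r s)) -> is_young (diagrams r s).
Proof.
move=> sr; rewrite /is_young /diagrams mem_filter ltnn /= andbT.
exact: sorted_filter geq_transitive _ _ sr.
Qed.

(** The sum is the coefficient of q^d in a product of one generating polynomial per label, and each
    of these is evaluated by the Cauchy identity. *)
Lemma sum_toda_functions n (N Nt : 'I_n -> nat) (vp vm : 'I_n -> C)
    (x : var N -> R) (y : var Nt -> R) d :
  \sum_(r : {ffun 'I_n.+1 -> d.-tuple 'I_d.+1} |
      [forall s, sorted geq (map val (r s))] && (\sum_s sumn (map val (r s)) == d)%N)
    toda_plus_fun vp (diagrams r) x * toda_minus_fun vm (diagrams r) y
  = complete (fun k => \sum_(s < n.+1)
      (psum x s k - psum x s.+1 k - \sum_(s.+1 <= b < n.+1) lab vp b)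
      * (psum y s.+1 k - psum y s k - \sum_(1 <= b < s.+1) lab vm b)) d.
Proof.
pose g (s : 'I_n.+1) k := psum x s k - psum x s.+1 k - \sum_(s.+1 <= b < n.+1) lab vp b.
pose h (s : 'I_n.+1) k := psum y s.+1 k - psum y s k - \sum_(1 <= b < s.+1) lab vm b.
pose sf (t : d.-tuple 'I_d.+1) := [seq k <- map val t | (0 < k)%N].
(* Tuples with more than [d] cells are included too; they only affect coefficients above [d]. *)
pose P (s : 'I_n.+1) : {poly C} := \sum_(t : d.-tuple 'I_d.+1 | sorted geq (map val t))
   (schur (sf t) (g s) * schur (sf t) (h s)) *: 'X^(sumn (map val t)).
transitivity ((\prod_s P s)`_d).
  rewrite /P; under [in RHS]eq_bigr do rewrite big_mkcond.
  rewrite bigA_distr_bigA /= coef_sum big_mkcond /=; apply: eq_bigr => r _.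
  case: (boolP [forall s, _]) => [/forallP sr|/forallPn[s rs]] /=; last first.
    by rewrite (bigD1 s) //= (negbTE rs) mul0r coef0.
  under [in RHS]eq_bigr do rewrite sr.
  rewrite scaler_prod prodrXr coefZ coefXn eq_sym.
  case: eqP => _; last by rewrite mulr0.
  by rewrite mulr1 big_split.
rewrite (@coef_prod_complete _ _ _ P (fun s k => g s k * h s k) d) // => s k kd.
rewrite /P coef_sum -(sum_schur_schur (g s) (h s) kd) big_mkcondr.
by apply: eq_bigr => t _; rewrite coefZ coefXn eq_sym; case: eqP => _; rewrite ?mulr1 ?mulr0.
Qed.
End Toda.

(** * Equality of the coefficients and the AGT relation *)

Lemma fps_binom_cancel (K : numFieldType) (c : K) (f : nat -> K) :
  fps_mul (fps_binom 1 (- c)) (fps_mul f (fps_binom 1 c)) =1 f.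
Proof.
move=> d; rewrite (funext (fps_mulC f _)) fps_mulA.
rewrite (_ : fps_mul (fps_binom 1 (- c)) (fps_binom 1 c) = @fps_one K) ?fps_mul1 //.
apply/funext => k; rewrite (funext (fps_binom_complete 1 (- c))).
rewrite (funext (fps_binom_complete 1 c)) -completeD -complete_cst0.
by apply: eq_complete => i _; ring.
Qed.

Theorem mainTheorem2 (R : realType) (n : nat) (hn : (1 <= n)%N)
  (N Nt : 'I_n -> nat) (up vp um vm : 'I_n -> R[i])
  (a : 'I_n.+1 -> R[i]) (mu : 'I_(n.+1 + n.+1) -> R[i])
  (Ep : ((var N -> R) -> R[i]) -> R[i])
  (Em : ((var Nt -> R) -> R[i]) -> R[i])
  (hEp : selberg_average up vp Ep)
  (hEm : selberg_average um vm Em)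
  (hvp : forall b : 'I_n, (0 < b)%N -> vp b = 0)
  (hvm : forall b : 'I_n, (0 < b)%N -> rev_lab vm b = 0)
  (hFp : selberg_formula up vp Ep)
  (hFm : selberg_formula (rev_lab um) (rev_lab vm) (rev_average Em))
  (hcharge : charge_conservation N Nt up vp um vm)
  (hdictp : dictionary N up vp a (fun s => mu (lshift n.+1 s)))
  (hdictm : dictionary (rev_lab Nt) (rev_lab um) (rev_lab vm)
              (rev_lab a) (fun s => mu (rshift n.+1 s)))
  (hdef : forall Y : 'I_n.+1 -> seq nat, (forall s, is_young (Y s)) ->
     forall t s, nek_G (Y t) (Y s) (a t - a s) != 0) :
  (forall Y : 'I_n.+1 -> seq nat, (forall s, is_young (Y s)) ->
     [/\ Ep (toda_plus_fun vp Y) = N_inst_plus a mu Y,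
         Em (toda_minus_fun vm Y) = N_inst_minus a mu Y
       & Ep (toda_plus_fun vp Y) * Em (toda_minus_fun vm Y) = N_inst a mu Y])
  /\ (exists kappa : R[i], forall d : nat,
        Z_inst a mu d = fps_mul (fps_binom 1 kappa) (Z_DF vp vm Ep Em) d).
Proof.
have plus Y : (forall s, is_young (Y s)) -> Ep (toda_plus_fun vp Y) = N_inst_plus a mu Y.
  by move=> yY; exact: (toda_plus_inst hn hFp hdictp).
have minus Y : (forall s, is_young (Y s)) -> Em (toda_minus_fun vm Y) = N_inst_minus a mu Y.
  move=> yY; rewrite -rev_average_toda (toda_plus_inst hn hFm hdictm) //.
    exact: N_inst_half_rev.
  move=> Z yZ t s; have := hdef (fun s => Z (rev_ord s)) (fun s => yZ _) (rev_ord t) (rev_ord s).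
  by rewrite !rev_ordK.
have both Y : (forall s, is_young (Y s)) ->
    Ep (toda_plus_fun vp Y) * Em (toda_minus_fun vm Y) = N_inst a mu Y.
  move=> yY; rewrite plus // minus // /N_inst_plus /N_inst_minus /N_inst_half mulf_div.
  rewrite mulrACA -!big_split /=; congr (_ / _).
    by apply: eq_bigr => s _; rewrite -expr2 sqrr_sign mul1r [RHS]big_split_ord.
  by apply: eq_bigr => t _; rewrite -big_split; apply: eq_bigr => s _; exact/esym/expr2.
split=> [Y yY|]; first by split; [exact: plus | exact: minus | exact: both].
(* The power of 1 - q that accompanies the Cauchy sum in the integrand, moved to the other side. *)
exists (- toda_shift vp vm) => d.
rewrite (_ : Z_DF vp vm Ep Em = fps_mul (Z_inst a mu) (fps_binom 1 (toda_shift vp vm))).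
  by rewrite fps_binom_cancel.
apply/funext => {}d; rewrite /Z_DF.
pose ok k (r : {ffun 'I_n.+1 -> k.-tuple 'I_k.+1}) :=
  [forall s, sorted geq (map val (r s))] && (\sum_s sumn (map val (r s)) == k)%N.
pose bin := fps_binom 1 (toda_shift vp vm).
pose W k (x : var N -> R) (y : var Nt -> R) :=
  \sum_(r : {ffun 'I_n.+1 -> k.-tuple 'I_k.+1} | ok k r)
    toda_plus_fun vp (diagrams r) x * toda_minus_fun vm (diagrams r) y.
have dfE x y : df_integrand vp vm x y d = \sum_(k < d.+1) bin (d - k)%N * W k x y.
  rewrite df_integrand_complete; apply: eq_bigr => k _.
  by rewrite /W sum_toda_functions mulrC.
(* The averages are taken one after the other. With [y] fixed, the functions of [y] are scalars, and
   each coefficient in q is a finite sum of polynomials in [x]. *)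
have EpE (y : var Nt -> R) :
  Ep (fun x => df_integrand vp vm x y d) = \sum_(k < d.+1) bin (d - k)%N *
   \sum_(r : {ffun 'I_n.+1 -> k.-tuple 'I_k.+1} | ok k r)
      Ep (toda_plus_fun vp (diagrams r)) * toda_minus_fun vm (diagrams r) y.
  rewrite (_ : (fun x => _) = fun x => \sum_(k < d.+1) bin (d - k)%N * W k x y); last first.
    by apply/funext => x; exact: dfE.
  rewrite (selberg_average_sum _ _ _ hEp) => [|k]; last first.
    apply: polyfun_sum => r; apply: polyfun_mul; last exact: polyfun_cst.
    exact: polyfun_toda_plus.
  apply: eq_bigr => k _; congr (_ * _).
  transitivity (Ep (fun x => \sum_(r : {ffun 'I_n.+1 -> k.-tuple 'I_k.+1} | ok k r)
     toda_minus_fun vm (diagrams r) y * toda_plus_fun vp (diagrams r) x)).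
    by congr Ep; apply/funext => x; apply: eq_bigr => r _; exact: mulrC.
  rewrite (selberg_average_sum _ _ _ hEp) => [|r]; last exact: polyfun_toda_plus.
  by apply: eq_bigr => r _; exact: mulrC.
rewrite (funext EpE).
rewrite (selberg_average_sum _ _ _ hEm) => [|k]; last first.
  apply: polyfun_sum => r; apply: polyfun_mul; first exact: polyfun_cst.
  exact: polyfun_toda_minus.
apply: eq_bigr => k _; rewrite mulrC; congr (_ * _).
rewrite (selberg_average_sum _ _ _ hEm) => [|r]; last exact: polyfun_toda_minus.
apply: eq_bigr => r /andP[/forallP sr _]; apply: both => s.
exact: diagrams_young.
Qed.
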